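(* Let $\mathcal G=(\{\mathcal S_i\}_{i=1}^n,\mathcal X,\sigma,\beta,K)$ be any competing content creation game with noise parameter $\beta>0$ and integer $1\le K\le n$. Then $$PoA(\mathcal G)<1+\frac{1}{c(\beta,K)},\qquad c(\beta,K)=\frac{(b+1)\log(b+K)}{(b+K)\big(\log(b+K)-\log K\big)},\quad b=e^{1/\beta}-1 .$$
   Context: A competing content creation game $\mathcal G=(\{\mathcal S_i\}_{i=1}^n,\mathcal X,\sigma,\beta,K)$ consists of: a finite set of users $\mathcal X=\{x_1,\dots,x_m\}\subset\mathbb R^d$; players $i\in[n]=\{1,\dots,n\}$ (content creators), player $i$ having an action set $\mathcal S_i\subset\mathbb R^d$ (not necessarily finite); a relevance function $\sigma:\mathbb R^d\times\mathbb R^d\to[0,1]$; a noise parameter $\beta>0$; and an integer $K$ with $1\le K\le n$. Let $\mathcal S=\prod_{i=1}^n\mathcal S_i$. For a joint strategy $s=(s_1,\dots,s_n)\in\mathcal S$ and user $x_j$, the top-$K$ list $\mathcal T_j(s;K)$ is the set of the first $K$ players $l_1,\dots,l_K$ of an ordering $l_1,\dots,l_n$ of $[n]$ with $\sigma(s_{l_1},x_j)\ge\cdots\ge\sigma(s_{l_n},x_j)$ (ties broken uniformly at random). Let $\varepsilon_1,\dots,\varepsilon_n$ be i.i.d. Gumbel random variables with location $-\beta\gamma$ and scale $\beta$ (CDF $t\mapsto\exp(-e^{-(t+\beta\gamma)/\beta})$, $\gamma$ the Euler–Mascheroni constant, so they have mean zero). User $j$ chooses $i_j^*=\arg\max_{i\in\mathcal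 T_j(s;K)}\{\sigma(s_i,x_j)+\varepsilon_i\}$; write $x_j\to s_i$ for the event $i_j^*=i$. User utility: $\pi_j(s)=\mathbb E[\max_{i\in\mathcal T_j(s;K)}\{\sigma(s_i,x_j)+\varepsilon_i\}]$. Player utility: $u_i(s)=\sum_{j=1}^m\mathbb E[\sigma(s_i,x_j)+\varepsilon_i\mid x_j\to s_i]\cdot\Pr[x_j\to s_i]$. Social welfare: $W(s)=\sum_{j=1}^m\pi_j(s)$. A coarse correlated equilibrium (CCE) is a probability distribution $\alpha$ on $\mathcal S$ such that for every player $i$ and every $s_i'\in\mathcal S_i$, $\mathbb E_{s\sim\alpha}[u_i(s)]\ge\mathbb E_{s\sim\alpha}[u_i(s_i',s_{-i})]$. The price of anarchy is $PoA(\mathcal G)=\dfrac{\max_{s\in\mathcal S}W(s)}{\min_{\alpha\in CCE(\mathcal G)}\mathbb E_{s\sim\alpha}[W(s)]}$, where $CCE(\mathcal G)$ is the set of CCEs.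
   Formalization: The bound is proved as W(s) < (1+1/c) E[W] for every joint strategy s and every CCE, which gives the PoA bound when max and min are attained; the degenerate case where both welfares vanish (e.g. K=1, σ=0), in which PoA is 0/0, is allowed as an exception. *)

(* Defs.v *)
From mathcomp Require Import all_boot all_order all_algebra perm.
From mathcomp Require Import all_classical all_reals all_analysis.
Import Order.TTheory GRing.Theory Num.Theory.
Local Open Scope ring_scope.

Definition euler_gamma {R : realType} : R :=
  limn (fun N : nat => \sum_(1 <= k < N.+1) (k%:R)^-1 - ln (N%:R : R)).

(* Density of the Gumbel law with location -beta*gamma and scale beta, i.e.
   the derivative of the CDF t |-> exp(-exp(-(t + beta*gamma)/beta)). *)
Definition gumbel_pdf {R : realType} (beta t : R) : R :=
  let z := (t + beta * euler_gamma) / beta in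
  beta^-1 * expR (- z) * expR (- expR (- z)).

(* gexp beta k f = E[f(eps)] where eps_0, ..., eps_{k-1} are i.i.d. Gumbel
   (location -beta*gamma, scale beta), written as an iterated Lebesgue
   integral (coordinates >= k are set to 0 and are irrelevant). *)
Fixpoint gexp {R : realType} (beta : R) (k : nat) (f : (nat -> R) -> R) : R :=
  match k with
  | 0 => f (fun _ => 0)
  | k'.+1 => Rintegral (@lebesgue_measure R) setT
      (fun t => gumbel_pdf beta t *
                gexp beta k' (fun e => f (fun i => if i == k' then t else e i)))
  end.


(* An ordering l_0,...,l_{n-1} of the players (a permutation p with l_t = p t)
   sorted by non-increasing relevance for user x. *)
Definition valid_order {R : realType} {dd n : nat}
  (sigma : 'rV[R]_dd -> 'rV[R]_dd -> R) (s : 'I_n -> 'rV[R]_dd)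
  (x : 'rV[R]_dd) (p : {perm 'I_n}) : bool :=
  [forall k : 'I_n, forall k' : 'I_n,
     (k <= k')%N ==> (sigma (s (p k')) x <= sigma (s (p k)) x)].

Definition valid_orders {R : realType} {dd n : nat}
  (sigma : 'rV[R]_dd -> 'rV[R]_dd -> R) (s : 'I_n -> 'rV[R]_dd)
  (x : 'rV[R]_dd) : {set {perm 'I_n}} :=
  [set p | valid_order sigma s x p].

Definition topK {n : nat} (K : nat) (p : {perm 'I_n}) : {set 'I_n} :=
  [set p t | t : 'I_n & (t < K)%N].

Definition noisy_max {R : realType} {dd n : nat}
  (sigma : 'rV[R]_dd -> 'rV[R]_dd -> R) (s : 'I_n -> 'rV[R]_dd)
  (x : 'rV[R]_dd) (T : {set 'I_n}) (e : nat -> R) : R :=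
  fine (\big[maxe/-oo%E]_(i in T) (sigma (s i) x + e i)%:E).

(* event "x -> s_i" given top-K list T and noise e (ties have probability 0) *)
Definition chosen {R : realType} {dd n : nat}
  (sigma : 'rV[R]_dd -> 'rV[R]_dd -> R) (s : 'I_n -> 'rV[R]_dd)
  (x : 'rV[R]_dd) (T : {set 'I_n}) (i : 'I_n) (e : nat -> R) : bool :=
  (i \in T) &&
  [forall l in T, (l != i) ==> (sigma (s l) x + e l < sigma (s i) x + e i)].

(* pi_j(s): expectation over the uniform tie-breaking ordering and the noise *)
Definition user_utility {R : realType} {dd n : nat} (beta : R) (K : nat)
  (sigma : 'rV[R]_dd -> 'rV[R]_dd -> R) (s : 'I_n -> 'rV[R]_dd)
  (x : 'rV[R]_dd) : R :=
  (#|valid_orders sigma s x|%:R)^-1 *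
  \sum_(p in valid_orders sigma s x)
     gexp beta n (noisy_max sigma s x (topK K p)).

(* u_i(s) = sum_j E[sigma(s_i,x_j)+eps_i | x_j -> s_i] Pr[x_j -> s_i]
          = sum_j E[(sigma(s_i,x_j)+eps_i) 1{x_j -> s_i}] *)
Definition player_utility {R : realType} {dd n m : nat} (beta : R) (K : nat)
  (sigma : 'rV[R]_dd -> 'rV[R]_dd -> R) (X : 'I_m -> 'rV[R]_dd)
  (s : 'I_n -> 'rV[R]_dd) (i : 'I_n) : R :=
  \sum_(j < m)
    (#|valid_orders sigma s (X j)|%:R)^-1 *
    \sum_(p in valid_orders sigma s (X j))
       gexp beta n (fun e => (sigma (s i) (X j) + e i) *
                             (chosen sigma s (X j) (topK K p) i e)%:R).

Definition welfare {R : realType} {dd n m : nat} (beta : R) (K : nat)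
  (sigma : 'rV[R]_dd -> 'rV[R]_dd -> R) (X : 'I_m -> 'rV[R]_dd)
  (s : 'I_n -> 'rV[R]_dd) : R :=
  \sum_(j < m) user_utility beta K sigma s (X j).

Definition deviate {R : realType} {dd n : nat} (s : 'I_n -> 'rV[R]_dd)
  (i : 'I_n) (a : 'rV[R]_dd) : 'I_n -> 'rV[R]_dd :=
  fun l => if l == i then a else s l.

(* A distribution alpha on S, represented as the law of a random joint strategy
   s : Omega -> S on a probability space (Omega, P), such that all the
   expectations used below are defined (measurability). *)
Definition random_profile {R : realType} {dd n m : nat} (beta : R) (K : nat)
  (S : 'I_n -> set 'rV[R]_dd) (sigma : 'rV[R]_dd -> 'rV[R]_dd -> R)
  (X : 'I_m -> 'rV[R]_dd) {d : measure_display} {Omega : measurableType d}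
  (s : Omega -> 'I_n -> 'rV[R]_dd) : Prop :=
  [/\ forall w i, S i (s w i),
      forall i, measurable_fun setT (fun w => player_utility beta K sigma X (s w) i),
      forall i a, S i a ->
        measurable_fun setT (fun w => player_utility beta K sigma X (deviate (s w) i a) i)
    & measurable_fun setT (fun w => welfare beta K sigma X (s w))].

Definition is_CCE {R : realType} {dd n m : nat} (beta : R) (K : nat)
  (S : 'I_n -> set 'rV[R]_dd) (sigma : 'rV[R]_dd -> 'rV[R]_dd -> R)
  (X : 'I_m -> 'rV[R]_dd) {d : measure_display} {Omega : measurableType d}
  (P : probability Omega R) (s : Omega -> 'I_n -> 'rV[R]_dd) : Prop :=
  random_profile beta K S sigma X s /\
  forall i a, S i a ->
    (\int[P]_w (player_utility beta K sigma X (deviate (s w) i a) i)%:E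
     <= \int[P]_w (player_utility beta K sigma X (s w) i)%:E)%E.

Definition cbK {R : realType} (beta : R) (K : nat) : R :=
  let b := expR beta^-1 - 1 in
  (b + 1) * ln (b + K%:R) / ((b + K%:R) * (ln (b + K%:R) - ln (K%:R : R))).

(* Main.v *)
(* Put w_i = exp (sigma_i / beta).  Gumbel noise gives closed forms: if Z is the
   sum of the K largest weights, the user's utility is beta ln Z, and a listed
   player i earns (w_i / Z) beta ln Z, so the players' utilities add up to the
   welfare.  Expectations of maxima of Gumbel variables are computed one
   variable at a time: with F_l(v) = exp (- l e^(-v/beta - gamma)) and h_l its
   primitive asymptotic to v at +oo, E[max a M] = h_l(a) when M has distribution
   function F_l, and F_w h_l - h_(l+w) is a primitive of F_w' h_l.

   The game is smooth: writing a for the K-th largest weight of s, a player whose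
   optimal weight exceeds a enters every list when deviating and earns at least
   c beta ln (1 + (w*_i - a) / Z).  Summing over the optimal list, as
   prod (1 + x_i) >= 1 + sum x_i, deviations from s to an optimal profile bring in total at
   least c (W* - W(s)), and strictly more if W(s) > 0.  Averaging over a coarse
   correlated equilibrium yields c (W* - EW) < EW unless both sides vanish. *)
Require Import Defs.
From mathcomp Require Import all_boot all_order all_algebra perm.
From mathcomp Require Import all_classical all_reals all_analysis.
From mathcomp Require Import measurable_realfun.
From mathcomp Require Import ring lra.
Set Implicit Arguments.
Unset Strict Implicit.
Unset Printing Implicit Defensive.
Import Order.TTheory GRing.Theory Num.Theory.
Import numFieldNormedType.Exports.
Local Open Scope classical_set_scope.
Local Open Scope ring_scope.

(** * Improper integrals from primitives *)

(** The constant [c] is the least ratio of what a deviator earns, [w / (w + r) * ln (w + r)], to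
    [ln ((w + r) / (r + 1))], where [w] is its weight and [r] the total weight of the [K - 1] other
    listed players. Weights lie between 1 and [exp (1 / beta)], so [r + 1 >= K]; the minimum sits at
    [r + 1 = K] and [w = exp (1 / beta)], which is the formula of [cbK].

    The closed forms hold only because the location [- beta * gamma] makes the noise exactly
    centred: any other location would leave an additive constant in each user's utility. Since
    [euler_gamma] is a limit of harmonic numbers minus logarithms, it must be identified with the
    constant in the asymptotics of the integrated Gumbel distribution function.

    The analytic difficulty is that each layer of the iterated expectation is an integral over the
    whole line of an integrand that may change sign and be unbounded, and it can be split and
    evaluated only once it is known to be integrable at both ends. *)

Lemma integrable_setU_disjoint {d} {T : measurableType d} {R : realType}
    {mu : {measure set T -> \bar R}} {A B : set T} {f : T -> \bar R} :
  measurable A -> measurable B -> [disjoint A & B] ->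
  mu.-integrable A f -> mu.-integrable B f -> mu.-integrable (A `|` B) f.
Proof.
move=> mA mB AB /integrableP[mfA fA] /integrableP[mfB fB].
have mf : measurable_fun (A `|` B) f by apply/measurable_funU.
apply/integrableP; split => //; rewrite ge0_integral_setU//.
  exact: lte_add_pinfty.
exact: measurableT_comp.
Qed.

Section deriv.
Context {R : realType}.
Implicit Types (f g F : R -> R) (a b x l : R) (D : set (measurableTypeR R)).

Lemma is_derive_le f f' a b : a <= b ->
  (forall x, a <= x <= b -> is_derive x 1 f (f' x)) ->
  (forall x, a < x < b -> 0 <= f' x) -> f a <= f b.
Proof.
move=> ab df f'0; rewrite -subr_ge0.
case: (ltgtP a b) ab => // [ab _|-> _]; last by rewrite subrr.
have cf : {within `[a, b], continuous f}.
  apply: derivable_within_continuous => x; rewrite in_itv/= => xab.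
  by have := df _ xab; move=> [].
have df' x : x \in `]a, b[ -> is_derive x 1 f (f' x).
  by rewrite in_itv/= => /andP[ax xb]; apply: df; rewrite !ltW.
have [c] := MVT ab df' cf.
by rewrite in_itv/= => cab ->; rewrite mulr_ge0 ?f'0// subr_ge0 ltW.
Qed.

Lemma is_derive_continuous f f' : (forall x, is_derive x 1 f (f' x)) -> continuous f.
Proof.
by move=> df x; apply: differentiable_continuous; apply/derivable1_diffP; have [] := df x.
Qed.

(** The value alone proves nothing, since [Rintegral] returns a number for every function. Linearity
    and splitting of the line also need integrability, so the two travel together. *)
Definition has_integral (D : set (measurableTypeR R)) f l :=
  (@lebesgue_measure R).-integrable D (EFin \o f) /\ Rintegral lebesgue_measure D f = l.

Lemma has_integral_eq D f g l : measurable D -> {in D, f =1 g} ->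
  has_integral D f l -> has_integral D g l.
Proof.
move=> mD fg [fi fl]; split; last by rewrite -fl; apply: eq_Rintegral => x xD; rewrite fg.
by apply: eq_integrable fi => // x xD /=; rewrite fg.
Qed.

Lemma has_integralB D f g k l : measurable D -> has_integral D f k -> has_integral D g l ->
  has_integral D (fun x => f x - g x) (k - l).
Proof.
move=> mD [fi <-] [gi <-]; split; last by rewrite RintegralB.
by have := integrableB mD fi gi; apply: eq_integrable.
Qed.

Lemma has_integralZ D c f l : measurable D -> has_integral D f l ->
  has_integral D (fun x => c * f x) (c * l).
Proof.
move=> mD [fi <-]; split; last by rewrite RintegralZl.
by have := integrableZl mD c fi; apply: eq_integrable.
Qed.

Lemma has_integral_itv_open f a l : has_integral `]-oo, a] f l -> has_integral `]-oo, a[ f l.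
Proof.
move=> [fi <-]; have gi : (@lebesgue_measure R).-integrable `]-oo, a[ (EFin \o f).
  by apply: integrableS fi => // x /=; rewrite !in_itv/=; exact: ltW.
by split=> //; rewrite /Rintegral integral_itv_bndo_bndc//; exact: measurable_int gi.
Qed.

Lemma has_integral_itv_openy f a l : has_integral `[a, +oo[ f l -> has_integral `]a, +oo[ f l.
Proof.
move=> [fi <-]; have gi : (@lebesgue_measure R).-integrable `]a, +oo[ (EFin \o f).
  by apply: integrableS fi => // x /=; rewrite !in_itv/= !andbT; exact: ltW.
by split=> //; rewrite /Rintegral integral_itv_obnd_cbnd//; exact: measurable_int gi.
Qed.

Lemma has_integral_setT D E f k l : measurable D -> measurable E -> D `|` E = setT ->
  [disjoint D & E] -> has_integral D f k -> has_integral E f l -> has_integral setT f (k + l).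
Proof.
move=> mD mE DE dDE [fi <-] [gi <-].
have := integrable_setU_disjoint mD mE dDE fi gi => fT.
by split; rewrite -?DE// Rintegral_setU.
Qed.

Lemma has_integral_splitl f a k l : has_integral `]-oo, a] f k -> has_integral `]a, +oo[ f l ->
  has_integral setT f (k + l).
Proof.
apply: has_integral_setT => //.
- apply/seteqP; split => // x _ /=; rewrite !in_itv/= andbT.
  by case: (leP x a) => _; [left|right].
- apply/disj_setPS => x [] /=; rewrite !in_itv/= andbT => xa ax.
  by move: (lt_le_trans ax xa); rewrite ltxx.
Qed.

Lemma has_integral_splitr f a k l : has_integral `]-oo, a[ f k -> has_integral `[a, +oo[ f l ->
  has_integral setT f (k + l).
Proof.
apply: has_integral_setT => //.
- apply/seteqP; split => // x _ /=; rewrite !in_itv/= andbT.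
  by case: (ltP x a) => _; [left|right].
- apply/disj_setPS => x [] /=; rewrite !in_itv/= andbT => xa ax.
  by move: (lt_le_trans xa ax); rewrite ltxx.
Qed.

Lemma has_integral_ge0 D f l : measurable D -> measurable_fun D f -> (forall x, D x -> 0 <= f x) ->
  (\int[lebesgue_measure]_(x in D) (f x)%:E = l%:E)%E -> has_integral D f l.
Proof.
move=> mD mf f0 fl; split; last by rewrite /Rintegral fl.
apply/integrableP; split; first exact/measurable_EFinP.
rewrite [ltLHS](_ : _ = l%:E) ?ltry// -fl; apply: eq_integral => x; rewrite inE => Dx /=.
by rewrite ger0_norm// f0.
Qed.

Lemma has_integral_ge0_y f F a l : continuous f ->
  (forall x, is_derive x 1 F (f x)) -> (forall x, a <= x -> 0 <= f x) ->
  F x @[x --> +oo] --> l -> has_integral `[a, +oo[ f (l - F a).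
Proof.
move=> cf dF f0 Fl; apply: has_integral_ge0 => //.
- exact: measurable_funTS (continuous_measurable_fun cf).
- by move=> x /=; rewrite in_itv/= andbT; exact: f0.
rewrite EFinB; apply: ge0_continuous_FTC2y => //.
- exact: continuous_subspaceT.
- by apply: cvg_at_right_filter; exact: is_derive_continuous dF _.
- by move=> x _; rewrite derive1E; exact: derive_val.
Qed.

Lemma has_integral_ge0_Ny f F a l : continuous f ->
  (forall x, is_derive x 1 F (f x)) -> (forall x, x <= a -> 0 <= f x) ->
  F x @[x --> -oo] --> l -> has_integral `]-oo, a] f (F a - l).
Proof.
move=> cf dF f0 Fl; apply: has_integral_ge0 => //.
- exact: measurable_funTS (continuous_measurable_fun cf).
- rewrite -[a]opprK ge0_integration_by_substitutionNy; last 2 first.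
  + exact: continuous_subspaceT.
  + by move=> x; rewrite in_itv/= opprK => xa; rewrite f0// ltW.
have cf' : continuous (f \o -%R).
  by move=> x; apply: continuous_comp; [exact: opp_continuous|exact: cf].
have dF' x : is_derive x 1 (fun y => - F (- y)) ((f \o -%R) x).
  by apply: is_derive_eq; rewrite /GRing.scale /=; ring.
have Fl' : - F (- x) @[x --> +oo] --> - l.
  by apply: cvgN; exact: ((cvgNy_compNP F (nbhs l)).1 Fl).
have [|i e] := @has_integral_ge0_y _ _ (- a) _ cf' dF' _ Fl'.
  by move=> x xa /=; rewrite f0// lerNl.
rewrite -[LHS]fineK; last first.
  by have /integrable_fin_num := i; exact.
by congr EFin; rewrite [LHS]e !opprK addrC.
Qed.

Section weighted.
Variables (p P : R -> R).
Hypotheses (cp : continuous p) (p0 : forall x, 0 <= p x).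
Hypothesis dP : forall x, is_derive x 1 P (p x).
Hypotheses (P1 : P x @[x --> +oo] --> (1 : R)) (P0 : P x @[x --> -oo] --> (0 : R)).

Let itvy a : measurable (`[a, +oo[%classic : set (measurableTypeR R)). Proof. by []. Qed.
Let itvNy a : measurable (`]-oo, a]%classic : set (measurableTypeR R)). Proof. by []. Qed.

(* Adding a multiple of the density makes the integrand nonnegative. *)
Lemma has_integral_weighted_y psi G a c l : continuous psi ->
  (forall x, is_derive x 1 G (p x * psi x)) ->
  (forall x, a <= x -> c <= psi x) ->
  G x @[x --> +oo] --> l -> has_integral `[a, +oo[ (fun x => p x * psi x) (l - G a).
Proof.
move=> cpsi dG cle Gl.
have i1 : has_integral `[a, +oo[ (fun x => p x * (psi x - c)) ((l - c * 1) - (G a - c * P a)).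
  apply: (has_integral_ge0_y (F := fun x => G x - c * P x)).
  - move=> x; apply: cvgM; first exact: cp.
    by apply: cvgB; [exact: cpsi|exact: cvg_cst].
  - by move=> x; apply: is_derive_eq; rewrite /GRing.scale /=; ring.
  - by move=> x ax; rewrite mulr_ge0// subr_ge0 cle.
  - by apply: cvgB => //; apply: cvgM => //; exact: cvg_cst.
have i2 : has_integral `[a, +oo[ p (1 - P a) by exact: has_integral_ge0_y.
have := has_integralB (itvy a) i1 (has_integralZ (- c) (itvy a) i2).
rewrite [X in has_integral _ _ X -> _](_ : _ = l - G a); last by ring.
by apply: has_integral_eq => // x _; ring.
Qed.

Lemma has_integral_weighted_Ny psi G a c l : continuous psi ->
  (forall x, is_derive x 1 G (p x * psi x)) ->
  (forall x, x <= a -> c <= psi x) ->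
  G x @[x --> -oo] --> l -> has_integral `]-oo, a] (fun x => p x * psi x) (G a - l).
Proof.
move=> cpsi dG cle Gl.
have i1 : has_integral `]-oo, a] (fun x => p x * (psi x - c)) ((G a - c * P a) - (l - c * 0)).
  apply: (has_integral_ge0_Ny (F := fun x => G x - c * P x)).
  - move=> x; apply: cvgM; first exact: cp.
    by apply: cvgB; [exact: cpsi|exact: cvg_cst].
  - by move=> x; apply: is_derive_eq; rewrite /GRing.scale /=; ring.
  - by move=> x ax; rewrite mulr_ge0// subr_ge0 cle.
  - by apply: cvgB => //; apply: cvgM => //; exact: cvg_cst.
have i2 : has_integral `]-oo, a] p (P a - 0) by exact: has_integral_ge0_Ny.
have := has_integralB (itvNy a) i1 (has_integralZ (- c) (itvNy a) i2).
rewrite [X in has_integral _ _ X -> _](_ : _ = G a - l); last by ring.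
by apply: has_integral_eq => // x _; ring.
Qed.

(** Serves integrands that tend to [-oo] with their argument, such as the identity; negation
    exchanges the two kinds of bound. *)
Lemma has_integral_weighted_Ny_le psi G a c l : continuous psi ->
  (forall x, is_derive x 1 G (p x * psi x)) ->
  (forall x, x <= a -> psi x <= c) ->
  G x @[x --> -oo] --> l -> has_integral `]-oo, a] (fun x => p x * psi x) (G a - l).
Proof.
move=> cpsi dG cle Gl.
have := @has_integral_weighted_Ny (fun x => - psi x) (fun x => - G x) a (- c) (- l).
move=> h; have {}h : has_integral `]-oo, a] (fun x => p x * - psi x) (- G a - - l).
  apply: h => //.
  - by move=> x; apply: cvgN; exact: cpsi.
  - by move=> x; apply: is_derive_eq; rewrite /GRing.scale /=; ring.
  - by move=> x ax; rewrite lerN2 cle.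
  - exact: cvgN.
have := has_integralZ (- 1) (itvNy a) h.
rewrite [X in has_integral _ _ X -> _](_ : _ = G a - l); last by ring.
by apply: has_integral_eq => // x _; ring.
Qed.

End weighted.
End deriv.

(** * The Gumbel distribution and the Euler constant *)

Section gumbel.
Context {R : realType}.
Implicit Types (z t : R).

Lemma bernoulli_le (u : R) n : 0 <= u <= 1 -> 1 - u * n%:R <= (1 - u) ^+ n.
Proof.
case/andP=> u0 u1; elim: n => [|n ih]; first by rewrite mulr0 subr0 expr0.
rewrite exprS -natr1; have n0 : 0 <= n%:R :> R by rewrite ler0n.
have : 0 <= (1 - u) * ((1 - u) ^+ n - (1 - u * n%:R)) by rewrite mulr_ge0// subr_ge0.
by nra.
Qed.

Lemma is_derive_expr (f : R -> R) (f' z : R) n : is_derive z 1 f f' ->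
  is_derive z 1 (fun x => f x ^+ n.+1) (n.+1%:R * f z ^+ n * f').
Proof.
move=> df; elim: n => [|n ih]; first by rewrite expr0 mulr1 mul1r.
have -> : (fun x => f x ^+ n.+2) = (fun x => f x * f x ^+ n.+1) by apply/funext => x; rewrite exprS.
by apply: is_derive_eq; rewrite /GRing.scale/= -[n.+2%:R]natr1 [f z ^+ n.+1]exprS; ring.
Qed.

Definition gumbel_cdf z : R := expR (- expR (- z)).

Lemma gumbel_cdf_ge0 z : 0 <= gumbel_cdf z. Proof. exact: expR_ge0. Qed.

Lemma gumbel_cdf_le1 z : gumbel_cdf z <= 1.
Proof. by rewrite /gumbel_cdf expR_le1 oppr_le0 expR_ge0. Qed.

Lemma gumbel_cdf_ge z : 1 - expR (- z) <= gumbel_cdf z.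
Proof. exact: expR_ge1Dx. Qed.

Lemma gumbel_cdf_le_expR z : gumbel_cdf z <= expR z.
Proof.
rewrite /gumbel_cdf expRN -[expR z]invrK -(expRN z) lef_pV2 ?posrE ?expR_gt0//.
by have := expR_ge1Dx (expR (- z)); lra.
Qed.

Lemma is_derive_gumbel_cdf z : is_derive z 1 gumbel_cdf (expR (- z) * gumbel_cdf z).
Proof. by rewrite /gumbel_cdf; apply: is_derive_eq; rewrite /GRing.scale/=; ring. Qed.

Lemma continuous_gumbel_cdf : continuous gumbel_cdf.
Proof. exact: is_derive_continuous is_derive_gumbel_cdf. Qed.

Lemma cvg_expR_Ny : expR z @[z --> -oo] --> (0 : R).
Proof. by apply: ((cvgNy_compNP _ _).2); exact: cvgr_expR. Qed.

Lemma has_integral_expR_Ny a : has_integral `]-oo, a] (@expR R) (expR a - 0).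
Proof.
apply: (has_integral_ge0_Ny (F := expR)); first exact: continuous_expR.
- by move=> x _; exact: expR_ge0.
- exact: cvg_expR_Ny.
Qed.

Lemma integrable_gumbel_cdf a : (@lebesgue_measure R).-integrable `]-oo, a] (EFin \o gumbel_cdf).
Proof.
have [i _] := has_integral_expR_Ny a.
apply: (le_integrable _ _ _ i) => //.
- by apply/measurable_EFinP; exact: measurable_funTS (continuous_measurable_fun continuous_gumbel_cdf).
- move=> x _ /=; rewrite lee_fin !ger0_norm ?expR_ge0 ?gumbel_cdf_ge0//.
  exact: gumbel_cdf_le_expR.
Qed.

(** Substituting [u = exp (- t)] shows that this is the exponential integral [E_1 (exp (- z))]. Its
    expansion [E_1 x = - gamma - ln x + O(x)] at 0 is the source of the Euler constant. *)
Definition gumbel_icdf z : R := Rintegral lebesgue_measure `]-oo, z] gumbel_cdf.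

Lemma is_derive_gumbel_icdf z : is_derive z 1 gumbel_icdf (gumbel_cdf z).
Proof.
have z1 : z < z + 1 by rewrite ltrDl.
have [|d e] := continuous_FTC1 z1 (integrable_gumbel_cdf _) (ltNyr _).
  exact: continuous_gumbel_cdf.
by split; [exact: d|rewrite -derive1E; exact: e].
Qed.

Lemma gumbel_icdf_ge0 z : 0 <= gumbel_icdf z.
Proof. by apply: Rintegral_ge0 => x _; exact: gumbel_cdf_ge0. Qed.

Lemma gumbel_icdf_le_expR z : gumbel_icdf z <= expR z.
Proof.
have [i e] := has_integral_expR_Ny z.
rewrite -[leRHS]subr0 -e; apply: le_Rintegral => //; first exact: integrable_gumbel_cdf.
by move=> x _; exact: gumbel_cdf_le_expR.
Qed.

Let D z : R := z - gumbel_icdf z.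

Let dD z : is_derive z 1 D (1 - gumbel_cdf z).
Proof. by have := is_derive_gumbel_icdf z => h; apply: is_derive_eq. Qed.

Let D_le y z : y <= z -> D y <= D z.
Proof.
move=> yz; apply: (is_derive_le yz (fun x _ => dD x)) => x _.
by rewrite subr_ge0 gumbel_cdf_le1.
Qed.

(** [D] is nondecreasing while [D z + exp (- z)] is nonincreasing, because
    [1 - exp (- z) <= gumbel_cdf z <= 1]. The supremum [L] of [D] is therefore within [exp (- z)] of
    [D z]. *)
Let D_bound y z : D y <= D z + expR (- z).
Proof.
case: (leP y z) => [yz|/ltW zy].
  by rewrite (le_trans (D_le yz))// lerDl expR_ge0.
suff : - (D z + expR (- z)) <= - (D y + expR (- y)).
  by have := expR_ge0 (- y); lra.
apply: (@is_derive_le _ (fun x => - (D x + expR (- x))) (fun x => - (1 - gumbel_cdf x - expR (- x)))) => // x _.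
  have h := dD x; apply: is_derive_eq; rewrite /GRing.scale/=; ring.
by have := gumbel_cdf_ge x; lra.
Qed.

Let L : R := sup (range D).

Let has_sup_D : has_sup (range D).
Proof.
split; first by exists (D 0), 0.
by exists (D 0 + expR (- 0)) => _ [y _ <-]; exact: D_bound.
Qed.

Let D_le_L z : D z <= L.
Proof. by apply: sup_ubound; [case: has_sup_D|exists z]. Qed.

Let L_le_D z : L <= D z + expR (- z).
Proof.
by apply: ge_sup; [exists (D 0), 0|move=> _ [y _ <-]; exact: D_bound].
Qed.

(* [P_ N N] is a primitive of [1 - (1 - exp (- z) / N) ^+ N], which approximates
   the derivative [1 - gumbel_cdf] of [D]; it increases from [0] at [- ln N] to the
   [N]-th harmonic number at [+oo].  Hence the limit [L] of [D] is the Euler constant. *)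
Let y_ (N : nat) z : R := 1 - expR (- z) / N%:R.
Let P_ (N n : nat) z : R := \sum_(1 <= k < n.+1) y_ N z ^+ k / k%:R.

(** [y_ N] solves [y' = 1 - y], so the derivative of [y ^+ k / k] is [y ^+ (k - 1) - y ^+ k] and the
    sum telescopes. *)
Let dP_ N n z : is_derive z 1 (P_ N n) (1 - y_ N z ^+ n).
Proof.
elim: n => [|n ih].
  have -> : P_ N 0 = cst 0 by apply/funext => x; rewrite /P_ big_geq.
  by apply: is_derive_eq; rewrite expr0 subrr.
have -> : P_ N n.+1 = fun x => P_ N n x + (n.+1%:R)^-1 * y_ N x ^+ n.+1.
  by apply/funext => x; rewrite /P_ big_nat_recr//= [X in _ + X]mulrC.
have dy : is_derive z 1 (y_ N) (1 - y_ N z).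
  by rewrite /y_; apply: is_derive_eq; rewrite /GRing.scale/=; ring.
have := is_derive_expr n dy => dyn; apply: is_derive_eq; rewrite /GRing.scale/=.
by rewrite exprS; field; rewrite addrC natr1 pnatr_eq0.
Qed.

(** Put [u = t / n]. The left inequality is [1 - u <= exp (- u)] raised to the power [n]. For the
    right one, [exp (- u) * (1 + u) <= 1] gives [exp (- t) * (1 - u ^+ 2) ^+ n <= (1 - u) ^+ n], and
    Bernoulli's inequality bounds [(1 - u ^+ 2) ^+ n] from below. *)
Let expR_le_invn t n : t <= n%:R -> (0 < n)%N -> 0 <= t ->
  0 <= expR (- t) - (1 - t / n%:R) ^+ n <= t ^+ 2 * expR (- t) / n%:R.
Proof.
move=> tn n0 t0; have nR : 0 < n%:R :> R by rewrite ltr0n.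
have tn1 : t / n%:R <= 1 by rewrite ler_pdivrMr// mul1r.
have tn0 : 0 <= t / n%:R by rewrite divr_ge0// ltW.
have tE : expR (- t) = expR (- (t / n%:R)) ^+ n.
  by rewrite -expRM_natl; congr expR; field; rewrite gt_eqF.
have up : (1 - t / n%:R) ^+ n <= expR (- t).
  by rewrite tE lerXn2r ?nnegrE ?expR_ge0 ?subr_ge0// expR_ge1Dx.
rewrite subr_ge0 up/=.
have lo : expR (- t) * (1 - (t / n%:R) ^+ 2 * n%:R) <= (1 - t / n%:R) ^+ n.
  apply: (@le_trans _ _ (expR (- t) * (1 - (t / n%:R) ^+ 2) ^+ n)).
    by rewrite ler_wpM2l ?expR_ge0// bernoulli_le// exprn_ge0//= expr_le1.
  rewrite tE -exprMn lerXn2r ?nnegrE ?subr_ge0//.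
    by rewrite mulr_ge0 ?expR_ge0// subr_ge0 expr_le1.
  rewrite [1 - _ ^+ 2](_ : _ = (1 - t / n%:R) * (1 + t / n%:R)); last by ring.
  rewrite mulrCA ler_piMr ?subr_ge0// expRN mulrC ler_pdivrMr ?expR_gt0// mul1r.
  exact: expR_ge1Dx.
have -> : t ^+ 2 * expR (- t) / n%:R = expR (- t) * ((t / n%:R) ^+ 2 * n%:R).
  by field; rewrite gt_eqF.
by move: lo; rewrite mulrBr mulr1; lra.
Qed.

(** [P_ N N] and [D] have nearly equal derivatives on [[- ln N, ln N]], where [t = exp (- x)] stays
    below [N] and [expR_le_invn] applies. At the left end [P_ N N] vanishes and [D] is near
    [- ln N]; at the right end they are near the harmonic number and [L]. Each error is of order
    [1 / N]. *)
Let harmonic_bound N : (0 < N)%N ->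
  `|L - (\sum_(1 <= k < N.+1) (k%:R)^-1 - ln N%:R)| <= 3 / N%:R.
Proof.
move=> N0; have NR : 0 < N%:R :> R by rewrite ltr0n.
have N1 : 1 <= N%:R :> R by rewrite ler1n.
have eN : expR (- ln N%:R) = N%:R^-1 :> R by rewrite expRN lnK.
have enN : expR (ln N%:R) = N%:R :> R by rewrite lnK.
have ln0 : 0 <= ln N%:R :> R by rewrite ln_ge0.
have lnn : - ln N%:R <= ln N%:R :> R by lra.
have P0 : P_ N N (- ln N%:R) = 0.
  rewrite /P_ big_nat; apply: big1 => k /andP[k0 _].
  by rewrite /y_ opprK enN divff ?gt_eqF// subrr expr0n gtn_eqF// mul0r.
have D0 : 0 <= - D (- ln N%:R) - ln N%:R <= N%:R^-1.
  have := gumbel_icdf_ge0 (- ln N%:R); have := gumbel_icdf_le_expR (- ln N%:R).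
  by rewrite /D eN; lra.
have tb (x : R) : - ln N%:R <= x -> 0 <= expR (- x) <= N%:R.
  move=> lx; rewrite expR_ge0/=.
  have : expR (- x) <= expR (ln (N%:R : R)) by rewrite ler_expR; lra.
  by rewrite enN.
have lo : P_ N N (- ln N%:R) - D (- ln N%:R) <= P_ N N (ln N%:R) - D (ln N%:R).
  apply: (@is_derive_le _ (fun x => P_ N N x - D x)
    (fun x => (1 - y_ N x ^+ N) - (1 - gumbel_cdf x))) => // x.
    by move=> _; have h1 := dP_ N N x; have h2 := dD x; apply: is_derive_eq.
  move=> /andP[/ltW/tb/andP[t0 tN] _].
  by have := expR_le_invn tN N0 t0; rewrite /y_ /gumbel_cdf; lra.
(* [(1 + exp (- x)) * gumbel_cdf x] is a primitive of [exp (- x) ^+ 2 * gumbel_cdf x], the error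
   term of [expR_le_invn] before division by [N]. It lies between 0 and 1, so the correction costs
   at most [1 / N]. *)
have up : - (P_ N N (- ln N%:R) - D (- ln N%:R) - N%:R^-1 * ((1 + expR (- - ln N%:R)) * gumbel_cdf (- ln N%:R))) <=
  - (P_ N N (ln N%:R) - D (ln N%:R) - N%:R^-1 * ((1 + expR (- ln N%:R)) * gumbel_cdf (ln N%:R))).
  apply: (@is_derive_le _ (fun x => - (P_ N N x - D x - N%:R^-1 * ((1 + expR (- x)) * gumbel_cdf x)))
    (fun x => - ((1 - y_ N x ^+ N) - (1 - gumbel_cdf x) - expR (- x) ^+ 2 * gumbel_cdf x / N%:R))) => // x.
    move=> _; have h1 := dP_ N N x; have h2 := dD x; have h3 := is_derive_gumbel_cdf x.
    by apply: is_derive_eq; rewrite /GRing.scale/=; ring.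
  move=> /andP[/ltW/tb/andP[t0 tN] _].
  by have := expR_le_invn tN N0 t0; rewrite /y_ /gumbel_cdf; lra.
have g1 : (1 + expR (- ln N%:R)) * gumbel_cdf (ln N%:R) <= 1.
  rewrite /gumbel_cdf; set t := expR (- _); rewrite expRN ler_pdivrMr ?expR_gt0// mul1r; exact: expR_ge1Dx.
have g2 : 0 <= N%:R^-1 * ((1 + expR (- - ln N%:R)) * gumbel_cdf (- ln N%:R)).
  apply: mulr_ge0; first by rewrite invr_ge0 ler0n.
  apply: mulr_ge0; last exact: gumbel_cdf_ge0.
  by apply: addr_ge0; [exact: ler01|exact: expR_ge0].
have {g1} : N%:R^-1 * ((1 + expR (- ln N%:R)) * gumbel_cdf (ln N%:R)) <= N%:R^-1 :> R.
  by rewrite ler_piMr ?invr_ge0 ?ler0n.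
move: up g2; set A := N%:R^-1 * _; set B := N%:R^-1 * _ => up A0 B1.
have v01 : 0 <= (N%:R^-1 : R) / N%:R <= 1.
  rewrite divr_ge0 ?invr_ge0 ?ler0n//= -invfM invf_le1 ?mulr_gt0//.
  by rewrite (le_trans N1)// ler_peMl ?ler0n.
have y01 : 0 <= y_ N (ln N%:R) <= 1 by rewrite /y_ eN; lra.
have Ple : P_ N N (ln N%:R) <= \sum_(1 <= k < N.+1) (k%:R)^-1.
  apply: ler_sum_nat => k _; rewrite ler_piMl ?invr_ge0 ?ler0n//.
  by case/andP: y01 => y0 y1; rewrite exprn_ile1.
(* Here [y_ N (ln N) = 1 - 1 / N ^+ 2], so by Bernoulli's inequality each of the [N] terms loses at
   most [1 / N ^+ 2]. *)
have Pge : \sum_(1 <= k < N.+1) (k%:R)^-1 - N%:R^-1 <= P_ N N (ln N%:R).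
  have -> : N%:R^-1 = \sum_(1 <= k < N.+1) N%:R^-1 / N%:R :> R.
    by rewrite sumr_const_nat subn1 -[_ *+ _]mulr_natr/=; field; rewrite gt_eqF.
  rewrite -sumrB; apply: ler_sum_nat => k /andP[k0 _].
  have kR : 0 < k%:R :> R by rewrite ltr0n.
  rewrite lerBlDr -(@ler_pM2r _ k%:R)// mulrDl !mulVf ?gt_eqF//.
  rewrite divfK ?gt_eqF// -lerBlDr; have := bernoulli_le k v01.
  by rewrite /y_ eN.
have := D_le_L (ln N%:R); have := L_le_D (ln N%:R); rewrite eN.
have i0 : 0 <= N%:R^-1 :> R by rewrite invr_ge0 ler0n.
by rewrite ler_norml; move: up lo; rewrite P0 => up lo; lra.
Qed.

Lemma euler_gammaE : euler_gamma = L.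
Proof.
apply/cvg_lim; first exact: Rhausdorff.
apply/cvgrPdist_le => e e0; near=> N.
have N0 : (0 < N)%N by near: N; exact: nbhs_infty_gt.
apply: (le_trans (harmonic_bound N0)).
rewrite ler_pdivrMr ?ltr0n// mulrC -ler_pdivrMr// ltW//.
by near: N; exact: nbhs_infty_gtr.
Unshelve. all: by end_near. Qed.

Lemma gumbel_icdf_bounds z : z - euler_gamma <= gumbel_icdf z <= z - euler_gamma + expR (- z).
Proof.
by rewrite euler_gammaE; have := D_le_L z; have := L_le_D z; rewrite /D; lra.
Qed.

End gumbel.

(** * Maxima of shifted Gumbel variables *)

Section weighted_gumbel.
Context {R : realType}.
Variable beta : R.
Hypothesis beta0 : 0 < beta.
Implicit Types (v w a c l lam x s t : R).

Lemma cvgy_le_inv (f : R -> R) c l : (forall v, 0 < v -> `|l - f v| <= c / v) ->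
  f v @[v --> +oo] --> l.
Proof.
move=> fc; apply/cvgrPdist_le => e e0; near=> v.
have v0 : 0 < v by near: v; apply: nbhs_pinfty_gt; rewrite num_real.
rewrite (le_trans (fc _ v0))// ler_pdivrMr// mulrC -ler_pdivrMr// ltW//.
Unshelve. all: by end_near. Qed.

Lemma cvgNy_le_inv (f : R -> R) c l : (forall v, 0 < v -> `|l - f (- v)| <= c / v) ->
  f v @[v --> -oo] --> l.
Proof. by move=> fc; apply: (cvgNy_compNP f (nbhs l)).2; exact: cvgy_le_inv fc. Qed.

Let expR_inv v : 0 < v -> expR (- (v / beta)) <= beta / v.
Proof.
move=> v0; rewrite expRN -[leRHS]invrK invfM invrK lef_pV2 ?posrE ?expR_gt0 ?divr_gt0//.
  by have := expR_ge1Dx (v / beta); rewrite [_^-1 * _]mulrC; lra.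
by rewrite mulrC divr_gt0.
Qed.

Let expR_inv2 v : 0 < v -> v * expR (- (v / beta)) <= 2 * beta ^+ 2 / v.
Proof.
move=> v0; rewrite expRN ler_pdivrMr ?expR_gt0//.
have vb : 0 <= v / beta by rewrite divr_ge0// ltW.
have := expR_ge1Dxn 1 vb; rewrite (_ : 2`!%:R = 2 :> R)//.
set X := expR _ => X1; have {X1} : v ^+ 2 / (2 * beta ^+ 2) <= X.
  rewrite (le_trans _ X1)// -[leLHS]add0r lerD//.
  by rewrite expr_div_n [leRHS](_ : _ = v ^+ 2 / (2 * beta ^+ 2))//; field; rewrite gt_eqF.
rewrite ler_pdivrMr ?mulr_gt0 ?exprn_gt0// => h.
by rewrite mulrAC ler_pdivlMr// -expr2 mulrC.
Qed.

(* [gE v] is the exponent of the Gumbel distribution function [exp (- gE v)];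
   the maximum of [sigma_i + eps_i] has distribution function
   [wcdf lam] with [lam = \sum_i exp (sigma_i / beta)]. *)
Definition gE v : R := expR (- (v / beta + euler_gamma)).
Definition wcdf lam v : R := expR (- (lam * gE v)).
Definition wpdf w v : R := w / beta * gE v * wcdf w v.

(* The primitive of [wcdf lam] asymptotic to the identity at [+oo]; it is also
   the expectation of [max v M], where [M] has distribution function [wcdf lam]. *)
Definition wexp lam v : R :=
  if lam == 0 then v else beta * (gumbel_icdf (v / beta + euler_gamma - ln lam) + ln lam).

Lemma gE_gt0 v : 0 < gE v. Proof. exact: expR_gt0. Qed.

Lemma wcdf_ge0 lam v : 0 <= wcdf lam v. Proof. exact: expR_ge0. Qed.

Lemma wcdf_le1 lam v : 0 <= lam -> wcdf lam v <= 1.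
Proof. by move=> l0; rewrite /wcdf expR_le1 oppr_le0 mulr_ge0// ltW// gE_gt0. Qed.

Lemma wcdf_ge lam v : 1 - lam * gE v <= wcdf lam v.
Proof. exact: expR_ge1Dx. Qed.

Lemma wcdf0 v : wcdf 0 v = 1. Proof. by rewrite /wcdf mul0r oppr0 expR0. Qed.

Lemma wcdfD lam w v : wcdf lam v * wcdf w v = wcdf (lam + w) v.
Proof. by rewrite /wcdf -expRD; congr expR; ring. Qed.

Lemma is_derive_gE v : is_derive v 1 gE (- (beta^-1 * gE v)).
Proof. by rewrite /gE; apply: is_derive_eq; rewrite /GRing.scale/=; ring. Qed.

Lemma is_derive_wcdf lam v : is_derive v 1 (wcdf lam) (wpdf lam v).
Proof.
by have h := is_derive_gE v; rewrite /wpdf /wcdf; apply: is_derive_eq; rewrite /GRing.scale/=; ring.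
Qed.

Lemma is_derive_wexp lam v : 0 <= lam -> is_derive v 1 (wexp lam) (wcdf lam v).
Proof.
rewrite le0r => /predU1P[->|lam0].
  have -> : wexp 0 = id by apply/funext => x; rewrite /wexp eqxx.
  by rewrite wcdf0; apply: is_derive_eq.
have -> : wexp lam = fun x => beta * (gumbel_icdf (x / beta + euler_gamma - ln lam) + ln lam).
  by apply/funext => x; rewrite /wexp gt_eqF.
have h := is_derive_gumbel_icdf (v / beta + euler_gamma - ln lam).
apply: is_derive_eq; rewrite /GRing.scale/= /gumbel_cdf opprB expRD lnK ?posrE//.
by rewrite -/(wcdf lam v) /wcdf/gE; field; rewrite gt_eqF.
Qed.

Lemma continuous_wexp lam : 0 <= lam -> continuous (wexp lam).
Proof. by move=> l0; exact: is_derive_continuous (fun v => is_derive_wexp v l0). Qed.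

Lemma continuous_wcdf lam : continuous (wcdf lam).
Proof. exact: is_derive_continuous (is_derive_wcdf lam). Qed.

Lemma wexp_bounds lam v : 0 <= lam -> v <= wexp lam v <= v + beta * lam * gE v.
Proof.
rewrite le0r => /predU1P[->|lam0].
  by rewrite /wexp eqxx mulr0 mul0r addr0 lexx.
rewrite /wexp gt_eqF//; have := gumbel_icdf_bounds (v / beta + euler_gamma - ln lam).
rewrite opprB expRD lnK ?posrE// -/(gE v); set I := gumbel_icdf _ => /andP[I1 I2].
have vE : v = beta * (v / beta) by field; rewrite gt_eqF.
apply/andP; split; first by rewrite {1}vE ler_pM2l//; lra.
by rewrite {1}vE -mulrA -mulrDr ler_pM2l//; lra.
Qed.

Lemma wexp_ge_ln lam v : 0 < lam -> beta * ln lam <= wexp lam v.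
Proof.
move=> lam0; rewrite /wexp gt_eqF// ler_pM2l//.
by have := gumbel_icdf_ge0 (v / beta + euler_gamma - ln lam); lra.
Qed.

Lemma wexp_le lam u v : 0 <= lam -> u <= v -> wexp lam u <= wexp lam v.
Proof.
move=> l0 uv; apply: (is_derive_le uv (fun x _ => is_derive_wexp x l0)) => x _.
exact: wcdf_ge0.
Qed.

Let gEy v : 0 < v -> gE v <= (expR (- euler_gamma) * beta) / v.
Proof.
move=> v0; rewrite /gE opprD expRD mulrC -mulrA ler_wpM2l ?expR_ge0//.
exact: expR_inv.
Qed.

Let vgEy v : 0 < v -> v * gE v <= (expR (- euler_gamma) * (2 * beta ^+ 2)) / v.
Proof.
move=> v0; rewrite /gE opprD expRD mulrA [leLHS]mulrC -mulrA ler_wpM2l ?expR_ge0//.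
exact: expR_inv2.
Qed.

Let wcdf_inv lam v : 0 < lam -> wcdf lam (- v) <= expR euler_gamma / lam * expR (- (v / beta)).
Proof.
move=> lam0; rewrite /wcdf expRN.
apply: (@le_trans _ _ (lam * gE (- v))^-1).
  rewrite lef_pV2 ?posrE ?expR_gt0 ?mulr_gt0 ?gE_gt0//.
  by have := expR_ge1Dx (lam * gE (- v)); lra.
rewrite /gE invfM -expRN opprK mulNr expRD.
by rewrite le_eqVlt; apply/orP; left; apply/eqP; ring.
Qed.

Lemma cvgy_wexp lam : 0 <= lam -> wexp lam v - v @[v --> +oo] --> (0 : R).
Proof.
move=> l0; apply: (@cvgy_le_inv _ (beta * lam * (expR (- euler_gamma) * beta))) => v v0.
have /andP[h1 h2] := wexp_bounds v l0.
rewrite sub0r normrN ger0_norm ?subr_ge0// -mulrA.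
rewrite (le_trans (_ : _ <= beta * lam * gE v)) ?lerBlDl//.
by rewrite ler_wpM2l ?gEy// mulr_ge0// ltW.
Qed.

Lemma cvgy_wcdf lam : 0 <= lam -> wcdf lam v @[v --> +oo] --> (1 : R).
Proof.
move=> l0; apply: (@cvgy_le_inv _ (lam * (expR (- euler_gamma) * beta))) => v v0.
rewrite ger0_norm ?subr_ge0 ?wcdf_le1// -mulrA.
rewrite (le_trans (_ : _ <= lam * gE v))//; first by have := wcdf_ge lam v; lra.
by rewrite ler_wpM2l ?gEy.
Qed.

Lemma cvgy_wcdfM lam : 0 <= lam -> (1 - wcdf lam v) * v @[v --> +oo] --> (0 : R).
Proof.
move=> l0; apply: (@cvgy_le_inv _ (lam * (expR (- euler_gamma) * (2 * beta ^+ 2)))) => v v0.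
have h := wcdf_le1 v l0; have h' := wcdf_ge lam v.
rewrite sub0r normrN ger0_norm ?mulr_ge0 ?subr_ge0 ?(ltW v0)// -mulrA.
rewrite (le_trans (_ : _ <= lam * (v * gE v)))//.
  by rewrite mulrA mulrAC ler_wpM2r ?(ltW v0)//; lra.
by rewrite ler_wpM2l ?vgEy.
Qed.

Lemma cvgNy_wcdf lam : 0 < lam -> wcdf lam v @[v --> -oo] --> (0 : R).
Proof.
move=> l0; apply: (@cvgNy_le_inv _ (expR euler_gamma / lam * beta)) => v v0.
rewrite sub0r normrN ger0_norm ?wcdf_ge0// (le_trans (wcdf_inv v l0))// -[leRHS]mulrA.
by rewrite ler_wpM2l ?expR_inv// divr_ge0 ?expR_ge0// ltW.
Qed.

Lemma cvgNy_wcdfM lam : 0 < lam -> wcdf lam v * v @[v --> -oo] --> (0 : R).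
Proof.
move=> l0; apply: (@cvgNy_le_inv _ (expR euler_gamma / lam * (2 * beta ^+ 2))) => v v0.
rewrite sub0r mulrN opprK ger0_norm ?mulr_ge0 ?wcdf_ge0 ?(ltW v0)//.
apply: (@le_trans _ _ (expR euler_gamma / lam * (v * expR (- (v / beta))))).
  by rewrite [X in _ <= _ * X]mulrC mulrA ler_wpM2r ?wcdf_inv// ltW.
by rewrite -[leRHS]mulrA ler_wpM2l ?expR_inv2// divr_ge0 ?expR_ge0// ltW.
Qed.

Lemma cvgNy_wexp lam : 0 < lam -> wexp lam v @[v --> -oo] --> (beta * ln lam : R).
Proof.
move=> l0; apply: (@cvgNy_le_inv _ (beta * (expR euler_gamma / lam * beta))) => v v0.
rewrite distrC ger0_norm ?subr_ge0 ?wexp_ge_ln// /wexp gt_eqF// -mulrBr addrK -mulrA.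
rewrite ler_pM2l// (le_trans (gumbel_icdf_le_expR _))//.
rewrite expRD [expR (- ln _)]expRN lnK ?posrE// expRD mulNr.
rewrite [leLHS](_ : _ = expR euler_gamma / lam * expR (- (v / beta))); last by ring.
by rewrite -[leRHS]mulrA ler_wpM2l ?expR_inv// divr_ge0 ?expR_ge0// ltW.
Qed.

(* Integration by parts: a primitive of [wpdf w * wexp lam]. *)
Definition wprim lam w v : R := wcdf w v * wexp lam v - wexp (lam + w) v.

Lemma is_derive_wprim lam w v : 0 <= lam -> 0 <= w ->
  is_derive v 1 (wprim lam w) (wpdf w v * wexp lam v).
Proof.
move=> l0 w0; have h1 := is_derive_wexp v l0; have h2 := is_derive_wcdf w v.
have h3 := is_derive_wexp v (addr_ge0 l0 w0); rewrite /wprim.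
by apply: is_derive_eq; rewrite /GRing.scale/= -wcdfD; ring.
Qed.

Lemma cvgy_wprim lam w : 0 <= lam -> 0 <= w -> wprim lam w v @[v --> +oo] --> (0 : R).
Proof.
move=> l0 w0.
(* Both terms of [wprim] grow like [v]; the regrouping exhibits three differences that vanish
   separately. *)
have -> : wprim lam w = fun v => wcdf w v * (wexp lam v - v) - (1 - wcdf w v) * v - (wexp (lam + w) v - v).
  by apply/funext => v; rewrite /wprim; ring.
rewrite (_ : nbhs 0 = nbhs (1 * 0 - 0 - 0 : R)); last by rewrite mulr0 !subr0.
apply: cvgB; last exact: cvgy_wexp (addr_ge0 _ _).
apply: cvgB; last exact: cvgy_wcdfM.
by apply: cvgM; [exact: cvgy_wcdf|exact: cvgy_wexp].
Qed.

Lemma cvgNy_wprim lam w : 0 <= lam -> 0 < w ->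
  wprim lam w v @[v --> -oo] --> (- (beta * ln (lam + w)) : R).
Proof.
move=> l0 w0; rewrite -[X in _ --> X]add0r; apply: cvgB; last first.
  by apply: cvgNy_wexp; rewrite ltr_wpDl.
move: l0; rewrite le0r => /predU1P[->|l0].
  have -> : wexp 0 = id by apply/funext => x; rewrite /wexp eqxx.
  exact: cvgNy_wcdfM.
rewrite (_ : nbhs 0 = nbhs (0 * (beta * ln lam) : R)); last by rewrite mul0r.
by apply: cvgM; [exact: cvgNy_wcdf|exact: cvgNy_wexp].
Qed.

End weighted_gumbel.

(** * One-variable integrals against the Gumbel density *)

Section gumbel_integrals.
Context {R : realType}.
Variable beta : R.
Hypothesis beta0 : 0 < beta.
Implicit Types (v w a c l lam x t : R) (psi G : R -> R).

(** A shift by [s] multiplies the exponent [gE] by [exp (s / beta)], so [wpdf] with that weight is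
    the density of [s + eps]. *)
Lemma gumbel_pdfE s t : gumbel_pdf beta t = wpdf beta (expR (s / beta)) (s + t).
Proof.
have e : expR (s / beta) * gE beta (s + t) = expR (- ((t + beta * euler_gamma) / beta)).
  by rewrite /gE -expRD; congr expR; field; rewrite gt_eqF.
by rewrite /gumbel_pdf /wpdf /wcdf /= -e; ring.
Qed.

Lemma gumbel_pdf_ge0 t : 0 <= gumbel_pdf beta t.
Proof. by rewrite /gumbel_pdf !mulr_ge0// ?invr_ge0 ?expR_ge0// ltW. Qed.

Let is_derive_cdf t : is_derive t 1 (wcdf beta 1) (gumbel_pdf beta t).
Proof. by rewrite (gumbel_pdfE 0) mul0r expR0 add0r; exact: is_derive_wcdf. Qed.

Let continuous_pdf : continuous (gumbel_pdf beta).
Proof.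
have -> : gumbel_pdf beta = fun t => beta^-1 * gE beta t * wcdf beta 1 t.
  by apply/funext => t; rewrite (gumbel_pdfE 0) mul0r expR0 add0r /wpdf mul1r.
apply: (@is_derive_continuous _ _ (fun t => _)) => t.
Qed.

Section shift.
Variable s : R.
Let w := expR (s / beta).
Let w0 : 0 < w. Proof. exact: expR_gt0. Qed.

Let continuous_shift psi : continuous psi -> continuous (fun t => psi (s + t)).
Proof.
move=> cpsi t; apply: continuous_comp (cpsi _).
by apply: cvgD; [exact: cvg_cst|exact: cvg_id].
Qed.

Let is_derive_shift psi G : (forall v, is_derive v 1 G (wpdf beta w v * psi v)) ->
  forall t, is_derive t 1 (fun t => G (s + t)) (gumbel_pdf beta t * psi (s + t)).
Proof.
move=> dG t; have h := dG (s + t).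
by apply: is_derive_eq; rewrite /GRing.scale/= (gumbel_pdfE s); ring.
Qed.

Lemma integral_pdf_y psi G a c l : continuous psi ->
  (forall v, is_derive v 1 G (wpdf beta w v * psi v)) ->
  (forall v, a <= v -> c <= psi v) -> G v @[v --> +oo] --> l ->
  has_integral `[a - s, +oo[ (fun t => gumbel_pdf beta t * psi (s + t)) (l - G a).
Proof.
move=> cpsi dG cle Gl; rewrite -[a in G a](subrKC s).
apply: (has_integral_weighted_y continuous_pdf gumbel_pdf_ge0 is_derive_cdf
  (cvgy_wcdf beta0 ler01) (c := c) (G := fun t => G (s + t))).
- exact: continuous_shift.
- exact: is_derive_shift.
- by move=> x ax; rewrite cle// -lerBlDl.
- exact: cvg_comp (cvg_addrl s) Gl.
Qed.

Lemma integral_pdf_Ny psi G a c l : continuous psi ->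
  (forall v, is_derive v 1 G (wpdf beta w v * psi v)) ->
  (forall v, v <= a -> c <= psi v) -> G v @[v --> -oo] --> l ->
  has_integral `]-oo, a - s] (fun t => gumbel_pdf beta t * psi (s + t)) (G a - l).
Proof.
move=> cpsi dG cle Gl; rewrite -[a in G a](subrKC s).
apply: (has_integral_weighted_Ny continuous_pdf gumbel_pdf_ge0 is_derive_cdf
  (cvgNy_wcdf beta0 ltr01) (c := c) (G := fun t => G (s + t))).
- exact: continuous_shift.
- exact: is_derive_shift.
- by move=> x ax; rewrite cle// -lerBrDl.
- exact: cvg_comp (cvg_addrl_Ny s) Gl.
Qed.

Lemma integral_pdf_Ny_le psi G a c l : continuous psi ->
  (forall v, is_derive v 1 G (wpdf beta w v * psi v)) ->
  (forall v, v <= a -> psi v <= c) -> G v @[v --> -oo] --> l ->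
  has_integral `]-oo, a - s] (fun t => gumbel_pdf beta t * psi (s + t)) (G a - l).
Proof.
move=> cpsi dG cle Gl; rewrite -[a in G a](subrKC s).
apply: (has_integral_weighted_Ny_le continuous_pdf gumbel_pdf_ge0 is_derive_cdf
  (cvgNy_wcdf beta0 ltr01) (c := c) (G := fun t => G (s + t))).
- exact: continuous_shift.
- exact: is_derive_shift.
- by move=> x ax; rewrite cle// -lerBrDl.
- exact: cvg_comp (cvg_addrl_Ny s) Gl.
Qed.

Let integral_pdf_cst_Ny a c :
  has_integral `]-oo, a - s] (fun t => gumbel_pdf beta t * c) (c * wcdf beta w a).
Proof.
rewrite -[_ * _]subr0.
apply: (@integral_pdf_Ny (cst c) (fun v => c * wcdf beta w v) a c) => //.
- exact: cst_continuous.
- move=> v; have h := is_derive_wcdf beta w v.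
  by apply: is_derive_eq; rewrite /GRing.scale/=; ring.
- rewrite -(mulr0 c); apply: cvgM; first exact: cvg_cst.
  exact: cvgNy_wcdf.
Qed.

Let integral_pdf_cst_y a c :
  has_integral `[a - s, +oo[ (fun t => gumbel_pdf beta t * c) (c - c * wcdf beta w a).
Proof.
rewrite [X in has_integral _ _ X](_ : _ = c * 1 - c * wcdf beta w a); last by rewrite mulr1.
apply: (@integral_pdf_y (cst c) (fun v => c * wcdf beta w v) a c) => //.
- exact: cst_continuous.
- move=> v; have h := is_derive_wcdf beta w v.
  by apply: is_derive_eq; rewrite /GRing.scale/=; ring.
- apply: cvgM; first exact: cvg_cst.
  by apply: cvgy_wcdf; rewrite // ltW.
Qed.

Lemma integral_pdf_cst c :
  Rintegral lebesgue_measure setT (fun t => gumbel_pdf beta t * c) = c.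
Proof.
have := has_integral_splitr (has_integral_itv_open (integral_pdf_cst_Ny 0 c)) (integral_pdf_cst_y 0 c).
by move=> [_ ->]; ring.
Qed.

Lemma integral_pdf_lt x c :
  Rintegral lebesgue_measure setT (fun t => gumbel_pdf beta t * ((s + t < x)%R%:R * c)) =
  wcdf beta w x * c.
Proof.
have h1 : has_integral `]-oo, x - s[ (fun t => gumbel_pdf beta t * ((s + t < x)%R%:R * c)) (c * wcdf beta w x).
  apply: has_integral_eq (has_integral_itv_open (integral_pdf_cst_Ny x c)) => // t.
  by rewrite inE/= in_itv/= ltrBrDl => ->; rewrite mul1r.
have h2 : has_integral `[x - s, +oo[ (fun t => gumbel_pdf beta t * ((s + t < x)%R%:R * c)) (0 - 0 * wcdf beta w x).
  apply: has_integral_eq (integral_pdf_cst_y x 0) => // t.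
  by rewrite inE/= in_itv/= andbT lerBlDl leNgt => /negbTE ->; rewrite mul0r.
have [_ ->] := has_integral_splitr h1 h2; ring.
Qed.

Lemma integral_pdf_max psi G a c l : continuous psi ->
  (forall v, is_derive v 1 G (wpdf beta w v * psi v)) ->
  (forall v, a <= v -> c <= psi v) -> G v @[v --> +oo] --> l ->
  Rintegral lebesgue_measure setT (fun t => gumbel_pdf beta t * psi (Num.max a (s + t))) =
  psi a * wcdf beta w a + (l - G a).
Proof.
move=> cpsi dG cle Gl.
have h1 : has_integral `]-oo, a - s[ (fun t => gumbel_pdf beta t * psi (Num.max a (s + t))) (psi a * wcdf beta w a).
  apply: has_integral_eq (has_integral_itv_open (integral_pdf_cst_Ny a (psi a))) => // t.
  by rewrite inE/= in_itv/= ltrBrDl => h; rewrite max_l// ltW.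
have h2 : has_integral `[a - s, +oo[ (fun t => gumbel_pdf beta t * psi (Num.max a (s + t))) (l - G a).
  apply: has_integral_eq (integral_pdf_y cpsi dG cle Gl) => // t.
  by rewrite inE/= in_itv/= andbT lerBlDl => h; rewrite max_r.
by have [] := has_integral_splitr h1 h2.
Qed.

Lemma integral_pdf_gt psi G a c l : continuous psi ->
  (forall v, is_derive v 1 G (wpdf beta w v * psi v)) ->
  (forall v, a <= v -> c <= psi v) -> G v @[v --> +oo] --> l ->
  Rintegral lebesgue_measure setT (fun t => gumbel_pdf beta t * ((a < s + t)%R%:R * psi (s + t))) =
  l - G a.
Proof.
move=> cpsi dG cle Gl.
have h1 : has_integral `]-oo, a - s] (fun t => gumbel_pdf beta t * ((a < s + t)%R%:R * psi (s + t))) (0 * wcdf beta w a).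
  apply: has_integral_eq (integral_pdf_cst_Ny a 0) => // t.
  by rewrite inE/= in_itv/= lerBrDl leNgt => /negbTE ->; rewrite mul0r.
have h2 : has_integral `]a - s, +oo[ (fun t => gumbel_pdf beta t * ((a < s + t)%R%:R * psi (s + t))) (l - G a).
  apply: has_integral_eq (has_integral_itv_openy (integral_pdf_y cpsi dG cle Gl)) => // t.
  by rewrite inE/= in_itv/= andbT ltrBlDl => ->; rewrite mul1r.
by have [_ ->] := has_integral_splitl h1 h2; rewrite mul0r add0r.
Qed.

(** The disjunction separates integrands bounded below at [-oo] from those that may tend to [-oo]
    there, as [wexp beta 0] does. *)
Lemma integral_pdf_T psi G c l k : continuous psi ->
  (forall v, is_derive v 1 G (wpdf beta w v * psi v)) ->
  (forall v, 0 <= v -> c <= psi v) ->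
  (forall v, v <= 0 -> psi v <= - c) \/ (forall v, v <= 0 -> c <= psi v) ->
  G v @[v --> +oo] --> l -> G v @[v --> -oo] --> k ->
  Rintegral lebesgue_measure setT (fun t => gumbel_pdf beta t * psi (s + t)) = l - k.
Proof.
move=> cpsi dG cle cle' Gl Gk; have h2 := integral_pdf_y cpsi dG cle Gl.
have h1 : has_integral `]-oo, 0 - s] (fun t => gumbel_pdf beta t * psi (s + t)) (G 0 - k).
  by case: cle' => cle'; [exact: integral_pdf_Ny_le cle' Gk|exact: integral_pdf_Ny cle' Gk].
have [_ ->] := has_integral_splitr (has_integral_itv_open h1) h2; ring.
Qed.

Lemma integral_pdf_wexp lam a : 0 <= lam ->
  Rintegral lebesgue_measure setT (fun t => gumbel_pdf beta t * wexp beta lam (Num.max a (s + t))) =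
  wexp beta (lam + w) a.
Proof.
move=> l0; apply: eq_trans; first apply: (@integral_pdf_max (wexp beta lam) (wprim beta lam w) a (wexp beta lam a) 0).
- exact: continuous_wexp.
- by move=> v; apply: is_derive_wprim; rewrite // ltW.
- by move=> v; exact: wexp_le.
- by apply: cvgy_wprim; rewrite // ltW.
- by rewrite /wprim; ring.
Qed.

Lemma integral_pdf_wexpT lam : 0 <= lam ->
  Rintegral lebesgue_measure setT (fun t => gumbel_pdf beta t * wexp beta lam (s + t)) =
  beta * ln (lam + w).
Proof.
(* [wexp] is monotone and nonnegative at 0, so [wexp beta lam 0] bounds it from above on the
   negative half-line and its opposite bounds it from below on the positive one. *)
move=> l0; apply: eq_trans; first apply: (@integral_pdf_T (wexp beta lam) (wprim beta lam w) (- wexp beta lam 0) 0 (- (beta * ln (lam + w)))).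
- exact: continuous_wexp.
- by move=> v; apply: is_derive_wprim; rewrite // ltW.
- move=> v v0; have h0 : 0 <= wexp beta lam 0 by have /andP[] := wexp_bounds beta0 0 l0.
  by have := wexp_le beta0 l0 v0; lra.
- by left => v v0; rewrite opprK wexp_le.
- by apply: cvgy_wprim; rewrite // ltW.
- exact: cvgNy_wprim.
- by rewrite opprK add0r.
Qed.

(** The density [wpdf w * wcdf lam] of winning at level [v] is the fraction [w / (lam + w)] of
    [wpdf (lam + w)]: the identity of the winner is independent of the value of the maximum. *)
Let wprim0_derive lam v : 0 <= lam ->
  is_derive v 1 (fun v => w / (lam + w) * wprim beta 0 (lam + w) v) (wpdf beta w v * (v * wcdf beta lam v)).
Proof.
move=> l0; have lw : 0 < lam + w by rewrite ltr_wpDl.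
have h := is_derive_wprim beta0 v (lexx 0) (ltW lw).
apply: is_derive_eq; rewrite /GRing.scale/= /wpdf -wcdfD /wexp eqxx.
by field; rewrite !gt_eqF.
Qed.

Let continuous_idM lam : continuous (fun v => v * wcdf beta lam v).
Proof. by move=> v; apply: cvgM; [exact: cvg_id|exact: continuous_wcdf]. Qed.

Lemma integral_pdf_id lam a : 0 <= lam ->
  Rintegral lebesgue_measure setT
    (fun t => gumbel_pdf beta t * ((a < s + t)%R%:R * ((s + t) * wcdf beta lam (s + t)))) =
  w / (lam + w) * (wexp beta (lam + w) a - a * wcdf beta (lam + w) a).
Proof.
move=> l0; have lw : 0 < lam + w by rewrite ltr_wpDl.
apply: eq_trans; first apply: (@integral_pdf_gt (fun v => v * wcdf beta lam v) (fun v => w / (lam + w) * wprim beta 0 (lam + w) v) a (- `|a|) (w / (lam + w) * 0)).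
- exact: continuous_idM.
- by move=> v; exact: wprim0_derive.
- move=> v av; have := wcdf_le1 beta v l0; have := wcdf_ge0 beta lam v.
  by case: (ger0P a) => a0; nra.
- apply: cvgM; first exact: cvg_cst.
  by apply: cvgy_wprim => //; rewrite ltW.
- by rewrite /wprim /wexp eqxx add0r; ring.
Qed.

Lemma integral_pdf_idT lam : 0 <= lam ->
  Rintegral lebesgue_measure setT (fun t => gumbel_pdf beta t * ((s + t) * wcdf beta lam (s + t))) =
  w / (lam + w) * (beta * ln (lam + w)).
Proof.
move=> l0; have lw : 0 < lam + w by rewrite ltr_wpDl.
apply: eq_trans; first apply: (@integral_pdf_T (fun v => v * wcdf beta lam v) (fun v => w / (lam + w) * wprim beta 0 (lam + w) v)
  0 (w / (lam + w) * 0) (w / (lam + w) * - (beta * ln (0 + (lam + w))))).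
- exact: continuous_idM.
- by move=> v; exact: wprim0_derive.
- by move=> v v0; rewrite mulr_ge0 ?wcdf_ge0.
- by left => v v0; rewrite oppr0 mulr_le0_ge0 ?wcdf_ge0.
- apply: cvgM; first exact: cvg_cst.
  by apply: cvgy_wprim => //; rewrite ltW.
- apply: cvgM; first exact: cvg_cst.
  exact: cvgNy_wprim.
- by rewrite add0r; ring.
Qed.

(** The expectation of [M] restricted to the event [M > v], for [M] with distribution function
    [wcdf lam]: from [E[max v M]] the part [v * P(M <= v)] is removed. *)
Definition wexp_id lam v : R := wexp beta lam v - v * wcdf beta lam v.

(** For [v >= 0] use [v <= wexp beta lam v]; for [v < 0] use [beta * ln lam <= wexp beta lam v],
    which is where [1 <= lam], hence a nonnegative relevance, enters. Nonnegativity gives the lower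
    bound that integrability needs at both ends. *)
Lemma wexp_id_ge0 lam v : 1 <= lam -> 0 <= wexp_id lam v.
Proof.
move=> l1; have l0 : 0 <= lam by rewrite (le_trans ler01).
rewrite /wexp_id; have h1 := wcdf_le1 beta v l0; have h0 := wcdf_ge0 beta lam v.
have /andP[h2 _] := wexp_bounds beta0 v l0.
have : 0 <= wexp beta lam v.
  by rewrite (le_trans _ (wexp_ge_ln beta0 v (lt_le_trans ltr01 l1)))// mulr_ge0 ?ln_ge0// ltW.
by nra.
Qed.

Let prim_id lam v : R := wprim beta lam w v - w / (lam + w) * wprim beta 0 (lam + w) v.

Let prim_id_derive lam v : 0 < lam ->
  is_derive v 1 (prim_id lam) (wpdf beta w v * wexp_id lam v).
Proof.
move=> l0; have h1 := wprim0_derive v (ltW l0).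
have h2 := is_derive_wprim beta0 v (ltW l0) (ltW w0).
by rewrite /prim_id; apply: is_derive_eq; rewrite /wexp_id; ring.
Qed.

Let continuous_wexp_id lam : 0 <= lam -> continuous (wexp_id lam).
Proof.
by move=> l0 v; apply: cvgB; [exact: continuous_wexp|exact: continuous_idM].
Qed.

Let cvgy_prim_id lam : 0 < lam -> prim_id lam v @[v --> +oo] --> (0 : R).
Proof.
move=> l0; have lw : 0 < lam + w by rewrite ltr_wpDl// ltW.
rewrite (_ : nbhs 0 = nbhs (0 - w / (lam + w) * 0 : R)); last by rewrite mulr0 subr0.
apply: cvgB; first by apply: cvgy_wprim => //; rewrite ltW.
apply: cvgM; first exact: cvg_cst.
by apply: cvgy_wprim => //; rewrite ltW.
Qed.

Let is_derive_cM c G psi : (forall v, is_derive v 1 G (wpdf beta w v * psi v)) ->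
  forall v, is_derive v 1 (fun v => c * G v) (wpdf beta w v * (c * psi v)).
Proof. by move=> h v; have := h v => ?; apply: is_derive_eq; rewrite /GRing.scale/=; ring. Qed.

Let cvg_cM c G l (F : set_system R) : Filter F -> G v @[v --> F] --> l -> c * G v @[v --> F] --> c * l.
Proof. by move=> FF h; apply: cvgM; [exact: cvg_cst|]. Qed.

Let continuous_cM c psi : continuous psi -> continuous (fun v => c * psi v).
Proof. by move=> h v; apply: cvgM; [exact: cvg_cst|exact: h]. Qed.

(** [M] with distribution function [wcdf lam] beats a newcomer of weight [w] with probability
    [lam / (lam + w)], independently of the larger of the two values, whose distribution function is
    [wcdf (lam + w)]. *)
Lemma integral_pdf_wexp_id lam a c : 1 <= lam -> 0 <= c ->
  Rintegral lebesgue_measure setT (fun t => gumbel_pdf beta t * (c * wexp_id lam (Num.max a (s + t)))) =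
  c * (lam / (lam + w) * wexp_id (lam + w) a).
Proof.
move=> l1 c0; have l0 : 0 < lam by rewrite (lt_le_trans ltr01).
have lw : 0 < lam + w by rewrite ltr_wpDl// ltW.
apply: eq_trans; first apply: (@integral_pdf_max (fun v => c * wexp_id lam v) (fun v => c * prim_id lam v) a 0 (c * 0)).
- by apply: continuous_cM; apply: continuous_wexp_id; rewrite ltW.
- by apply: is_derive_cM => v; exact: prim_id_derive.
- by move=> v _; rewrite mulr_ge0// wexp_id_ge0.
- by apply: cvg_cM; exact: cvgy_prim_id.
- rewrite /prim_id /wprim /wexp_id -wcdfD !add0r [wexp _ 0 _]/wexp eqxx.
  by field; rewrite gt_eqF.
Qed.

Lemma integral_pdf_wexp_idT lam c : 1 <= lam -> 0 <= c ->
  Rintegral lebesgue_measure setT (fun t => gumbel_pdf beta t * (c * wexp_id lam (s + t))) =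
  c * (lam / (lam + w) * (beta * ln (lam + w))).
Proof.
move=> l1 c0; have l0 : 0 < lam by rewrite (lt_le_trans ltr01).
have lw : 0 < lam + w by rewrite ltr_wpDl// ltW.
apply: eq_trans; first apply: (@integral_pdf_T (fun v => c * wexp_id lam v) (fun v => c * prim_id lam v) 0 (c * 0)
  (c * (- (beta * ln (lam + w)) - w / (lam + w) * - (beta * ln (0 + (lam + w)))))).
- by apply: continuous_cM; apply: continuous_wexp_id; rewrite ltW.
- by apply: is_derive_cM => v; exact: prim_id_derive.
- by move=> v _; rewrite mulr_ge0// wexp_id_ge0.
- by right => v _; rewrite mulr_ge0// wexp_id_ge0.
- by apply: cvg_cM; exact: cvgy_prim_id.
- apply: cvg_cM; apply: cvgB; first by apply: cvgNy_wprim => //; rewrite ltW.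
  by apply: cvg_cM; exact: cvgNy_wprim.
- by rewrite !add0r; field; rewrite gt_eqF.
Qed.

End shift.
End gumbel_integrals.

(** * Iterated expectations of maxima, one noise variable at a time *)

Section gexp_max.
Context {R : realType}.
Variable beta : R.
Hypothesis beta0 : 0 < beta.
Variables (T : pred nat) (sg : nat -> R).
Implicit Types (a x t c : R) (e : nat -> R) (k : nat).

Let w i : R := expR (sg i / beta).
Let w0 i : 0 < w i. Proof. exact: expR_gt0. Qed.

Lemma gexp_cst k c : gexp beta k (fun=> c) = c.
Proof.
elim: k => //= k ->; exact: (integral_pdf_cst beta0 0).
Qed.

(** Peels off the highest index first because [gexp] integrates it outermost: once that variable is
    fixed it is absorbed into the accumulator [a], and a maximum of the same shape over fewer
    variables remains. *)
Fixpoint rmax k a e : R :=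
  if k is k'.+1 then rmax k' (if T k' then Num.max a (sg k' + e k') else a) e else a.

(** The reals have no neutral element for the maximum, so the accumulator starts at the first listed
    index met; the value 0 stands for an empty list. *)
Fixpoint nmax k e : R :=
  if k is k'.+1 then (if T k' then rmax k' (sg k' + e k') e else nmax k' e) else 0.

Let upd e k t : nat -> R := fun i => if i == k then t else e i.

Let rmax_upd k m a e t : (k <= m)%N -> rmax k a (upd e m t) = rmax k a e.
Proof.
elim: k a => //= k ih a km; rewrite ih 1?ltnW//.
by rewrite /upd ltn_eqF.
Qed.

Let nmax_upd k m e t : (k <= m)%N -> nmax k (upd e m t) = nmax k e.
Proof.
elim: k => //= k ih km; rewrite ih 1?ltnW// rmax_upd 1?ltnW//.
by rewrite /upd ltn_eqF.
Qed.

Let wsum k : R := \sum_(i < k | T i) w i.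

Let wsumS k : wsum k.+1 = if T k then wsum k + w k else wsum k.
Proof. by rewrite /wsum big_mkcond big_ord_recr/= -big_mkcond; case: ifP => //; rewrite addr0. Qed.

Let wsum_ge0 k : 0 <= wsum k.
Proof. by apply: sumr_ge0 => i _; rewrite ltW. Qed.

Lemma gexp_rmax k a : gexp beta k (rmax k a) = wexp beta (wsum k) a.
Proof.
elim: k a => [|k ih] a /=; first by rewrite /wsum big_ord0 /wexp eqxx.
rewrite wsumS; transitivity (Rintegral lebesgue_measure setT (fun t => gumbel_pdf beta t *
  wexp beta (wsum k) (if T k then Num.max a (sg k + t) else a))).
  apply: eq_Rintegral => t _; congr (_ * _); rewrite -ih; congr gexp.
  by apply/funext => e; rewrite -/(upd e k t) rmax_upd// /upd eqxx.
case: ifP => _; last exact: (integral_pdf_cst beta0 0).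
exact: integral_pdf_wexp.
Qed.

Lemma gexp_nmax k : (exists2 i, (i < k)%N & T i) -> gexp beta k (nmax k) = beta * ln (wsum k).
Proof.
elim: k => [[]//|k ih [i ik Ti]] /=; rewrite wsumS.
have [Tk|nTk] := boolP (T k).
  rewrite -(integral_pdf_wexpT beta0 (sg k) (wsum_ge0 k)).
  apply: eq_Rintegral => t _; congr (_ * _); rewrite -gexp_rmax; congr gexp.
  by apply/funext => e; rewrite -/(upd e k t) rmax_upd// /upd eqxx.
rewrite -ih; last first.
  exists i => //; move: ik; rewrite ltnS leq_eqVlt => /predU1P[ik|//].
  by rewrite -ik Ti in nTk.
rewrite -[RHS](integral_pdf_cst beta0 0); apply: eq_Rintegral => t _; congr (_ * _); congr gexp.
by apply/funext => e; rewrite -/(upd e k t) nmax_upd.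
Qed.

Variable i0 : nat.

Fixpoint all_lt k x e : bool :=
  if k is k'.+1 then ((T k' && (k' != i0)) ==> (sg k' + e k' < x)) && all_lt k' x e else true.

Let all_lt_upd k m x e t : (k <= m)%N -> all_lt k x (upd e m t) = all_lt k x e.
Proof.
elim: k => //= k ih km; rewrite ih 1?ltnW//.
by rewrite /upd (ltn_eqF km).
Qed.

Let wsum' k : R := \sum_(i < k | T i && (i != i0 :> nat)) w i.

Let wsum'S k : wsum' k.+1 = if T k && (k != i0) then wsum' k + w k else wsum' k.
Proof. by rewrite /wsum' big_mkcond big_ord_recr/= -big_mkcond; case: ifP => //; rewrite addr0. Qed.

Let wsum'_ge0 k : 0 <= wsum' k.
Proof. by apply: sumr_ge0 => i _; rewrite ltW. Qed.

Lemma gexp_all_lt k x c : gexp beta k (fun e => c * (all_lt k x e)%:R) = c * wcdf beta (wsum' k) x.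
Proof.
elim: k c => [|k ih] c /=; first by rewrite /wsum' big_ord0 wcdf0.
rewrite wsum'S; case: (boolP (T k && _)) => Tk /=; last first.
  rewrite -ih -[RHS](integral_pdf_cst beta0 0); apply: eq_Rintegral => t _; congr (_ * _); congr gexp.
  by apply/funext => e; rewrite -/(upd e k t) all_lt_upd.
rewrite addrC -wcdfD mulrCA -integral_pdf_lt//.
apply: eq_Rintegral => t _; congr (_ * _); rewrite mulrA -ih; congr gexp.
apply/funext => e; rewrite -/(upd e k t) all_lt_upd// /upd eqxx.
by rewrite mulrC mulrAC; case: (_ < _); rewrite /= ?mul1r ?mul0r ?mulr1// mulrC.
Qed.

Hypothesis sg0 : 0 <= sg i0.
Let wi0 : 1 <= w i0.
Proof. by rewrite /w -expR0 ler_expR divr_ge0// ltW. Qed.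

Let wsum'1 k : 1 <= wsum' k + w i0.
Proof. by have := wsum'_ge0 k; have := wi0; lra. Qed.

Let wsum'_gt0 k : 0 < wsum' k + w i0.
Proof. exact: lt_le_trans ltr01 (wsum'1 k). Qed.

Let ratio_ge0 k : 0 <= w i0 / (wsum' k + w i0).
Proof. by rewrite divr_ge0// ltW. Qed.

(** The level [a] stands for the best of the competitors already fixed, those of index at least [k].
    For [k > i0] the next competitor merges into it as [Num.max a (sg k + t)]. Once [i0] itself is
    outermost, the competitors below it contribute the factor [wcdf]. *)
Lemma gexp_best_gt k a : (i0 < k)%N ->
  gexp beta k (fun e => (sg i0 + e i0) * ((a < sg i0 + e i0) && all_lt k (sg i0 + e i0) e)%:R) =
  w i0 / (wsum' k + w i0) * wexp_id beta (wsum' k + w i0) a.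
Proof.
elim: k a => // k ih a; rewrite ltnS leq_eqVlt => /predU1P[ik|ik] /=.
  rewrite wsum'S -ik eqxx andbF -(integral_pdf_id beta0 (sg i0) a (wsum'_ge0 i0)).
  apply: eq_Rintegral => t _; congr (_ * _).
  rewrite mulrA -gexp_all_lt; congr gexp; apply/funext => e.
  rewrite -/(upd e i0 t) all_lt_upd//=.
  by case: (a < _); rewrite /= ?mul1r// !(mul0r, mulr0).
rewrite wsum'S (gtn_eqF ik) andbT.
case: ifP => Tk; last first.
  rewrite -ih// -[RHS](integral_pdf_cst beta0 0).
  apply: eq_Rintegral => t _; congr (_ * _); congr gexp; apply/funext => e.
  by rewrite -/(upd e k t) ?(ltn_eqF ik) all_lt_upd.
rewrite [wsum' k + w k + _]addrAC.
transitivity (w i0 / (wsum' k + w i0) * ((wsum' k + w i0) / (wsum' k + w i0 + w k)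
   * wexp_id beta (wsum' k + w i0 + w k) a)); last first.
  have h1 := wsum'_gt0 k; have h2 : 0 < wsum' k + w i0 + w k by rewrite addr_gt0.
  by field; rewrite !gt_eqF.
rewrite -integral_pdf_wexp_id//; apply: eq_Rintegral => t _; congr (_ * _).
rewrite -ih//; congr gexp; apply/funext => e.
rewrite -/(upd e k t) ?(ltn_eqF ik) all_lt_upd// ?eqxx/=.
by rewrite gt_max andbA.
Qed.

(** There is no level to carry until a listed competitor of index above [i0] is met; that competitor
    supplies one, and [gexp_best_gt] takes over. *)
Lemma gexp_best k : (i0 < k)%N ->
  gexp beta k (fun e => (sg i0 + e i0) * (all_lt k (sg i0 + e i0) e)%:R) =
  w i0 / (wsum' k + w i0) * (beta * ln (wsum' k + w i0)).
Proof.
elim: k => // k ih; rewrite ltnS leq_eqVlt => /predU1P[ik|ik] /=.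
  rewrite wsum'S -ik eqxx andbF -(integral_pdf_idT beta0 (sg i0) (wsum'_ge0 i0)).
  apply: eq_Rintegral => t _; congr (_ * _).
  rewrite -gexp_all_lt; congr gexp; apply/funext => e.
  by rewrite -/(upd e i0 t) ?eqxx all_lt_upd.
rewrite wsum'S (gtn_eqF ik) andbT.
case: ifP => Tk; last first.
  rewrite -ih// -[RHS](integral_pdf_cst beta0 0).
  apply: eq_Rintegral => t _; congr (_ * _); congr gexp; apply/funext => e.
  by rewrite -/(upd e k t) ?(ltn_eqF ik) all_lt_upd.
rewrite [wsum' k + w k + _]addrAC.
transitivity (w i0 / (wsum' k + w i0) * ((wsum' k + w i0) / (wsum' k + w i0 + w k)
   * (beta * ln (wsum' k + w i0 + w k)))); last first.
  have h1 := wsum'_gt0 k; have h2 : 0 < wsum' k + w i0 + w k by rewrite addr_gt0.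
  by field; rewrite !gt_eqF.
rewrite -integral_pdf_wexp_idT//; apply: eq_Rintegral => t _; congr (_ * _).
rewrite -gexp_best_gt//; congr gexp; apply/funext => e.
by rewrite -/(upd e k t) ?(ltn_eqF ik) all_lt_upd// ?eqxx/=.
Qed.

End gexp_max.

(** * Utilities for a given top-K list *)

Section top_list.
Context {R : realType} {dd n : nat}.
Variables (beta : R) (sigma : 'rV[R]_dd -> 'rV[R]_dd -> R).
Variables (s : 'I_n -> 'rV[R]_dd) (x : 'rV[R]_dd) (T : {set 'I_n}).
Hypothesis beta0 : 0 < beta.
Implicit Types (e : nat -> R) (k : nat).

(* The Gumbel expectations are indexed by natural numbers: extend the players'
   data by junk values. *)
Let TN k : bool := if insub k is Some j then j \in T else false.
Let sgN k : R := if insub k is Some j then sigma (s j) x else 0.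

Let TNE (i : 'I_n) : TN i = (i \in T). Proof. by rewrite /TN valK. Qed.
Let sgNE (i : 'I_n) : sgN i = sigma (s i) x. Proof. by rewrite /sgN valK. Qed.

Let rmaxE k a e : (rmax TN sgN k a e)%:E =
  maxe a%:E (\big[maxe/-oo%E]_(i < k | TN i) (sgN i + e i)%:E).
Proof.
elim: k a => [|k ih] a /=; first by rewrite big_ord0 maxeNy.
rewrite ih [in RHS]big_mkcond big_ord_recr/= -big_mkcond.
case: ifP => _; last by rewrite maxeNy.
by rewrite [X in _ = maxe _ X]maxC maxA EFin_max.
Qed.

Let nmaxE k e : nmax TN sgN k e = fine (\big[maxe/-oo%E]_(i < k | TN i) (sgN i + e i)%:E).
Proof.
elim: k => [|k ih] /=; first by rewrite big_ord0.
rewrite [in RHS]big_mkcond big_ord_recr/= -big_mkcond.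
by case: ifP => _; [rewrite maxC -rmaxE|rewrite maxeNy ih].
Qed.

Let noisy_maxE e : noisy_max sigma s x T e = nmax TN sgN n e.
Proof.
rewrite nmaxE /noisy_max; congr fine; apply: eq_big => i; first by rewrite TNE.
by rewrite sgNE.
Qed.

Let sumE (P : pred nat) : \sum_(i < n | TN i && P i) expR (sgN i / beta) =
  \sum_(i in T | P i) expR (sigma (s i) x / beta).
Proof. by apply: eq_big => i; rewrite ?TNE ?sgNE. Qed.

Lemma gexp_noisy_max : (0 < #|T|)%N ->
  gexp beta n (noisy_max sigma s x T) = beta * ln (\sum_(i in T) expR (sigma (s i) x / beta)).
Proof.
move=> /card_gt0P[i iT]; transitivity (gexp beta n (nmax TN sgN n)).
  by congr gexp; apply/funext => e; exact: noisy_maxE.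
rewrite gexp_nmax//; last by exists i; [exact: ltn_ord|rewrite TNE].
by congr (_ * ln _); apply: eq_big => j; rewrite ?TNE ?sgNE.
Qed.

Let all_ltP k i0 y e : reflect
  (forall l, (l < k)%N -> TN l -> l != i0 -> sgN l + e l < y) (all_lt TN sgN i0 k y e).
Proof.
elim: k => [|k ih] /=; first exact: ReflectT.
apply: (iffP andP) => [[/implyP h1 /ih h2] l|h].
  rewrite ltnS leq_eqVlt => /predU1P[-> Tk ki|]; last exact: h2.
  by apply: h1; rewrite Tk.
split; first by apply/implyP => /andP[Tk ki]; exact: h.
by apply/ih => l lk; apply: h; rewrite ltnS ltnW.
Qed.

Let chosenE (i : 'I_n) e : i \in T ->
  chosen sigma s x T i e = all_lt TN sgN i n (sgN i + e i) e.
Proof.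
move=> iT; rewrite /chosen iT/=; apply/forall_inP/all_ltP => [h l ln Tl li|h l lT].
  have {h} := h (Ordinal ln); rewrite -TNE => /(_ Tl)/implyP.
  by rewrite -!sgNE; apply.
by apply/implyP => li; rewrite -!sgNE; apply: h; rewrite ?TNE.
Qed.

Lemma gexp_chosen (i : 'I_n) : 0 <= sigma (s i) x -> i \in T ->
  gexp beta n (fun e => (sigma (s i) x + e i) * (chosen sigma s x T i e)%:R) =
  let Z := \sum_(i in T) expR (sigma (s i) x / beta) in
  expR (sigma (s i) x / beta) / Z * (beta * ln Z).
Proof.
move=> si0 iT; rewrite -[in LHS]sgNE.
transitivity (gexp beta n (fun e => (sgN i + e i) * (all_lt TN sgN i n (sgN i + e i) e)%:R)).
  by congr gexp; apply/funext => e; rewrite chosenE.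
rewrite gexp_best ?sgNE//= (sumE (fun l => l != i)) addrC.
by rewrite -(bigD1 i iT (F := fun i => expR (sigma (s i) x / beta))).
Qed.

Lemma gexp_notin (i : 'I_n) : i \notin T ->
  gexp beta n (fun e => (sigma (s i) x + e i) * (chosen sigma s x T i e)%:R) = 0.
Proof.
move=> iT; rewrite -[RHS](gexp_cst beta0 n); congr gexp; apply/funext => e.
by rewrite /chosen (negbTE iT) mulr0.
Qed.

End top_list.

(** * The constant [cbK] *)

Section numeric.
Context {R : realType}.
Implicit Types (x y t k w r q D : R).

Lemma ln_lower_bound k : 1 <= k -> 2 * (k - 1) <= (k + 1) * ln k.
Proof.
move=> k1; rewrite -subr_ge0.
have <- : (1 + 1) * ln 1 - 2 * (1 - 1) = 0 :> R by rewrite ln1; ring.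
apply: (@is_derive_le _ (fun x => (x + 1) * ln x - 2 * (x - 1)) (fun x => ln x + x^-1 - 1)) => // x.
  move=> /andP[x1 _]; have x0 : 0 < x by rewrite (lt_le_trans ltr01).
  have h := is_derive1_ln x0; apply: is_derive_eq; rewrite /GRing.scale/=.
  by field; rewrite gt_eqF.
move=> /andP[x1 _]; have x0 : 0 < x by rewrite (lt_trans ltr01).
have : -1 < x^-1 - 1 by rewrite ltrBrDr addNr invr_gt0.
by move=> /le_ln1Dx; rewrite addrC subrK lnV ?posrE//; lra.
Qed.

Let expR2 t : 0 <= t -> 1 + t + t ^+ 2 / 2 <= expR t.
Proof.
move=> t0; rewrite -subr_ge0.
have <- : expR 0 - (1 + 0 + 0 ^+ 2 / 2) = 0 :> R by rewrite expR0; ring.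
apply: (@is_derive_le _ (fun x => expR x - (1 + x + x * x / 2)) (fun x => expR x - (1 + x))) => // x _.
  by apply: is_derive_eq; rewrite /GRing.scale/=; field.
by rewrite subr_ge0 expR_ge1Dx.
Qed.

Lemma expR_ge_cubic t : 0 <= t -> 1 + t + t ^+ 2 / 2 + t ^+ 3 / 6 <= expR t.
Proof.
move=> t0; rewrite -subr_ge0.
have <- : expR 0 - (1 + 0 + 0 ^+ 2 / 2 + 0 ^+ 3 / 6) = 0 :> R by rewrite expR0; ring.
apply: (@is_derive_le _ (fun x => expR x - (1 + x + x * x / 2 + x * (x * x) / 6))
  (fun x => expR x - (1 + x + x ^+ 2 / 2))) => // x.
  by move=> _; apply: is_derive_eq; rewrite /GRing.scale/=; field.
by move=> /andP[x0 _]; rewrite subr_ge0 expR2// ltW.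
Qed.

(* The sign of the derivative of [y (ln y - ln k) / ((y - k + 1) ln y)]. *)
Lemma ln_ratio_derive_sign k y : 1 <= k -> k <= y ->
  (k - 1) * (ln y * (ln y - ln k)) <= (y - k + 1) * ln k.
Proof.
move=> k1 ky; have k0 : 0 < k by rewrite (lt_le_trans ltr01).
have y0 : 0 < y by rewrite (lt_le_trans k0).
have t0 : 0 <= ln y - ln k by rewrite subr_ge0 ler_ln.
have yE : y = k * expR (ln y - ln k) by rewrite expRB !lnK ?posrE//; field; rewrite gt_eqF.
have L0 : 0 <= ln k by rewrite ln_ge0.
have lk := ln_lower_bound k1.
have := expR_ge_cubic t0.
move: yE L0 lk t0; set E := expR _; set L := ln k; set t := ln y - L => yE L0 lk t0 eE.
have -> : ln y = L + t by rewrite /t; ring.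
(* With [t = ln (y / k)] and [L = ln k] the claim reads [(k - 1) * t ^+ 2 <= L * ((y - k + 1) - (k -
   1) * t)]. [Q] bounds the last factor from below by the cubic Taylor polynomial of [exp t], and
   [L >= 2 * (k - 1) / (k + 1)] reduces the claim to [(k + 1) * t ^+ 2 <= 2 * Q]. *)
set Q := 1 + t + k * (t ^+ 2 / 2) + k * (t ^+ 3 / 6).
have Q0 : 0 <= Q.
  have q2 : 0 <= k * (t ^+ 2 / 2) by apply: mulr_ge0; [exact: ltW|rewrite divr_ge0 ?exprn_ge0].
  have q3 : 0 <= k * (t ^+ 3 / 6) by apply: mulr_ge0; [exact: ltW|rewrite divr_ge0 ?exprn_ge0].
  by rewrite /Q; lra.
have QE : Q <= (y - k + 1) - (k - 1) * t.
  by rewrite {1}yE /Q; have := ler_wpM2l (ltW k0) eE; lra.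
have h1 : L * Q <= L * ((y - k + 1) - (k - 1) * t) by rewrite ler_wpM2l.
have h2 : 2 * (k - 1) * Q <= (k + 1) * L * Q by rewrite ler_wpM2r.
have h3 : 0 <= (k - 1) * (2 * Q - (k + 1) * t ^+ 2).
  rewrite mulr_ge0 ?subr_ge0// /Q.
  have t3 : t ^+ 3 <= k * t ^+ 3 by rewrite ler_peMl ?exprn_ge0.
  have : 0 <= t * (t - 1) ^+ 2 by rewrite mulr_ge0 ?sqr_ge0.
  have : 0 <= t ^+ 2 by rewrite sqr_ge0.
  by move: t3; rewrite !exprS expr0 !mulr1; nra.
have h4 : 0 <= (k + 1) * (L * Q - (k - 1) * t ^+ 2) by lra.
have k10 : 0 < k + 1 by lra.
by move: h4; rewrite pmulr_rge0// => h4; lra.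
Qed.

(** With [y = w - 1 + k] the quotient is the inverse of the ratio that [cbK] minimises, taken at
    [r + 1 = k]. Its growth makes the largest weight the worst case. *)
Lemma ln_ratio_le k y1 y2 : 1 <= k -> k < y1 -> y1 <= y2 ->
  y1 * (ln y1 - ln k) / ((y1 - k + 1) * ln y1) <= y2 * (ln y2 - ln k) / ((y2 - k + 1) * ln y2).
Proof.
move=> k1 ky1 y12.
apply: (@is_derive_le _ (fun y => y * (ln y - ln k) / ((y - k + 1) * ln y))
  (fun y => ((y - k + 1) * ln k - (k - 1) * (ln y * (ln y - ln k))) / ((y - k + 1) * ln y) ^+ 2)) => // y.
  move=> /andP[y1y _]; have y0 : 0 < y by lra.
  have l0 : ln y != 0 by rewrite gt_eqF// ln_gt0//; lra.
  have m0 : y - k + 1 != 0 by rewrite gt_eqF//; lra.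
  have M0 : (y - k + 1) * ln y != 0 by rewrite mulf_neq0.
  have h := is_derive1_ln y0; apply: is_derive_eq; rewrite /GRing.scale/=.
  by rewrite expr2; field; rewrite l0 m0 gt_eqF.
move=> /andP[y1y _]; rewrite divr_ge0 ?sqr_ge0// subr_ge0 ln_ratio_derive_sign//; lra.
Qed.

(** The derivative in [q] is [ln (1 + D / q) - D / q <= 0]. With [D = w - 1] and [q = r + 1] this
    makes the lightest other players the worst case. *)
Lemma ln_ratio_shift_le D q1 q2 : 0 <= D -> 0 < q1 -> q1 <= q2 ->
  (q2 + D) * (ln (q2 + D) - ln q2) <= (q1 + D) * (ln (q1 + D) - ln q1).
Proof.
move=> D0 q10 q12; rewrite -lerN2.
apply: (@is_derive_le _ (fun q => - ((q + D) * (ln (q + D) - ln q)))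
  (fun q => - (ln (q + D) - ln q - D / q))) => // q /andP[q1q _].
  have q0 : 0 < q by lra.
  have qD : 0 < q + D by lra.
  have h := is_derive1_ln q0; have h' := is_derive1_ln qD.
  apply: is_derive_eq; rewrite /GRing.scale/=.
  by field; rewrite !gt_eqF.
have q0 : 0 < q by lra.
have qD : 0 < q + D by lra.
have Dq : 0 <= D / q by rewrite divr_ge0// ltW.
have : -1 < D / q by lra.
move=> /le_ln1Dx; have -> : 1 + D / q = (q + D) / q by field; rewrite gt_eqF.
by rewrite ln_div ?posrE//; lra.
Qed.

Variables (beta : R) (K : nat).
Hypotheses (beta0 : 0 < beta) (K0 : (0 < K)%N).

Let B := expR beta^-1.
Let B1 : 1 < B. Proof. by rewrite /B expR_gt1 invr_gt0. Qed.
Let K1 : 1 <= K%:R :> R. Proof. by rewrite ler1n. Qed.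

Let lnKY : ln (K%:R : R) < ln (B - 1 + K%:R).
Proof. by rewrite ltr_ln ?posrE//; have := B1; have := K1; lra. Qed.

Let lnK0 : 0 <= ln (K%:R : R). Proof. exact: ln_ge0. Qed.

Lemma cbK_gt0 : 0 < cbK beta K.
Proof.
have := B1; have := K1; have := lnKY; have := lnK0 => l0 lY k1 b1.
by rewrite /cbK -/B divr_gt0// mulr_gt0//; lra.
Qed.

(** Two reductions lead to the extremal configuration: [r + 1] is lowered to [K], then [w] is raised
    to [B], where the quotient equals the inverse of [cbK]. In passing, [ln (w - 1 + K)] is replaced
    by the larger [ln (w + r)]. *)
Lemma share_lower_bound w r : 1 < w <= B -> K%:R <= r + 1 ->
  cbK beta K * ln ((w + r) / (r + 1)) <= w / (w + r) * ln (w + r).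
Proof.
move=> /andP[w1 wB] Kr; have := B1; have := K1; have := lnKY; have := lnK0 => l0 lY k1 b1.
have r1 : 0 < r + 1 by lra.
have wr : 0 < w + r by lra.
have h1 : (w + r) * (ln (w + r) - ln (r + 1)) <= (w - 1 + K%:R) * (ln (w - 1 + K%:R) - ln K%:R).
  have w10 : 0 <= w - 1 by lra.
  have K0' : 0 < K%:R :> R by lra.
  have := ln_ratio_shift_le w10 K0' Kr.
  by rewrite (_ : r + 1 + (w - 1) = w + r) ?[K%:R + _]addrC//; ring.
have Ky : K%:R < w - 1 + K%:R by lra.
have yY : w - 1 + K%:R <= B - 1 + K%:R by lra.
have := ln_ratio_le k1 Ky yY.
rewrite (_ : w - 1 + K%:R - K%:R + 1 = w); last by ring.
rewrite (_ : B - 1 + K%:R - K%:R + 1 = B); last by ring.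
have ly : 0 < ln (w - 1 + K%:R) by rewrite ln_gt0//; lra.
have lyr : ln (w - 1 + K%:R) <= ln (w + r) by rewrite ler_ln ?posrE; lra.
have -> : (B - 1 + K%:R) * (ln (B - 1 + K%:R) - ln K%:R) / (B * ln (B - 1 + K%:R)) = (cbK beta K)^-1.
  by rewrite /cbK -/B invf_div subrK.
rewrite ler_pdivrMr ?mulr_gt0//; last lra.
rewrite ln_div ?posrE// => h2.
rewrite [leRHS]mulrAC ler_pdivlMr// -mulrA -ler_pdivlMl ?cbK_gt0// mulrC.
rewrite (le_trans h1)// (le_trans h2)// ler_wpM2l ?invr_ge0 ?(ltW cbK_gt0)//.
by rewrite ler_wpM2l//; lra.
Qed.

End numeric.

Local Close Scope classical_set_scope.

(** * Top-K lists *)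

Section top_sets.
Context {R : realType} {n : nat}.
Variable K : nat.
Hypotheses (K0 : (0 < K)%N) (Kn : (K <= n)%N).
Implicit Types (w : 'I_n -> R) (p q : {perm 'I_n}) (i l : 'I_n) (U : {set 'I_n}).

Definition sorted_orders w : {set {perm 'I_n}} :=
  [set p : {perm 'I_n} | [forall k : 'I_n, forall k' : 'I_n, (k <= k')%N ==> (w (p k') <= w (p k))]].

Lemma sorted_ordersP w p :
  reflect (forall k k' : 'I_n, (k <= k')%N -> w (p k') <= w (p k)) (p \in sorted_orders w).
Proof.
rewrite inE; apply: (iffP forallP) => [h k k' kk'|h k].
  by have /forallP/(_ k')/implyP := h k; apply.
by apply/forallP => k'; apply/implyP; exact: h.
Qed.

Lemma sorted_orders_neq0 w : (0 < #|sorted_orders w|)%N.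
Proof.
pose r := [rel i l : 'I_n | w l <= w i].
have r_total : total r by move=> i l; rewrite /= orbC le_total.
have r_trans : transitive r by move=> i l m /= h1 h2; exact: le_trans h2 h1.
have r_refl : reflexive r by move=> i; exact: lexx.
have /tuple_permP[p pE] : perm_eq (sort r (ord_tuple n)) (ord_tuple n) by rewrite perm_sort.
apply/card_gt0P; exists p; apply/sorted_ordersP => k k' kk'.
have kE (i : 'I_n) : nth k (sort r (ord_tuple n)) i = p i.
  by rewrite pE -tnth_nth tnth_map !tnth_ord_tuple.
rewrite -(kE k) -(kE k').
have /(sorted_leq_nth r_trans r_refl k) h := sort_sorted r_total (ord_tuple n).
by apply: h => //; rewrite inE size_sort size_tuple.
Qed.

Lemma mem_topK p m i : (i \in topK m p) = (p^-1%g i < m)%N.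
Proof.
apply/imsetP/idP => [[t tm ->]|h]; first by rewrite permK; rewrite inE in tm.
by exists (p^-1%g i); rewrite ?inE ?permKV.
Qed.

Lemma card_topK p m : (m <= n)%N -> #|topK m p| = m.
Proof.
move=> mn; rewrite card_imset; last exact: perm_inj.
rewrite -sum1_card -[RHS]card_ord -sum1_card (big_ord_widen n (fun=> 1%N) mn).
by apply: eq_bigl => t; rewrite inE.
Qed.

Let Kpred : (K.-1 < n)%N. Proof. by rewrite prednK. Qed.

Definition threshold w p : R := w (p (Ordinal Kpred)).
Definition top_weight w p : R := \sum_(i in topK K p) w i.

Lemma threshold_le w p i : p \in sorted_orders w -> i \in topK K p -> threshold w p <= w i.
Proof.
move=> /sorted_ordersP ps; rewrite mem_topK => iK.
by rewrite -[i in w i](permKV p); apply: ps; rewrite /= -ltnS prednK.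
Qed.

Lemma le_threshold w p i : p \in sorted_orders w -> i \notin topK K.-1 p -> w i <= threshold w p.
Proof.
move=> /sorted_ordersP ps; rewrite mem_topK -leqNgt => iK.
by rewrite -[i in w i](permKV p); apply: ps.
Qed.

Lemma le_threshold_top w p i : p \in sorted_orders w -> i \notin topK K p -> w i <= threshold w p.
Proof.
move=> ps; rewrite mem_topK => iK; apply: le_threshold => //.
by rewrite mem_topK; apply: contra iK => /leq_trans; apply; exact: leq_pred.
Qed.

Lemma card_above_threshold w p : p \in sorted_orders w -> (#|[set i | (threshold w p < w i)%R]| < K)%N.
Proof.
move=> ps; rewrite -(prednK K0) ltnS -[leqRHS](card_topK p (ltnW Kpred)).
apply: subset_leq_card; apply/fintype.subsetP => i; rewrite inE => h; apply: contraT => /(le_threshold ps).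
by rewrite leNgt h.
Qed.

(** Pigeonhole: fewer than [K] players lie strictly above the threshold. *)
Lemma exists_le_threshold w p U : p \in sorted_orders w -> #|U| = K ->
  exists2 l, l \in U & w l <= threshold w p.
Proof.
move=> ps cU; apply/exists_inP; apply: contraT; rewrite negb_exists_in => /forall_inP h.
have := card_above_threshold ps; rewrite -cU ltnNge => /negP; case.
by apply: subset_leq_card; apply/fintype.subsetP => i /h; rewrite inE -ltNge.
Qed.

Let sumBa U w (a : R) : \sum_(i in U) (w i - a) = \sum_(i in U) w i - #|U|%:R * a.
Proof. by rewrite sumrB sumr_const mulr_natl. Qed.

(** After subtraction of the threshold, listed players contribute nonnegative terms and all others
    nonpositive ones. No condition on [#|U|] is imposed, so the lemma can also serve for the empty
    set and for sets of [K - 1] players. *)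
Lemma top_weight_max w p U : p \in sorted_orders w ->
  \sum_(i in U) w i - #|U|%:R * threshold w p <= top_weight w p - K%:R * threshold w p.
Proof.
move=> ps; rewrite -sumBa.
have -> : top_weight w p - K%:R * threshold w p = \sum_(i in topK K p) (w i - threshold w p).
  by rewrite sumBa card_topK.
rewrite big_mkcond [leRHS]big_mkcond; apply: ler_sum => i _.
case: ifPn => _; case: ifPn => [iT|iT] //.
  by rewrite subr_le0 le_threshold_top.
by rewrite subr_ge0 threshold_le.
Qed.

Lemma top_weight_eq w p q : p \in sorted_orders w -> q \in sorted_orders w ->
  top_weight w p = top_weight w q.
Proof.
move=> ps qs; have := top_weight_max (topK K q) ps; have := top_weight_max (topK K p) qs.
rewrite !card_topK// -/(top_weight w p) -/(top_weight w q) => h1 h2.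
by apply/eqP; rewrite eq_le; apply/andP; split; lra.
Qed.

Lemma top_weight_ge w p : p \in sorted_orders w -> K%:R * threshold w p <= top_weight w p.
Proof.
by move=> ps; have := top_weight_max finset.set0 ps; rewrite big_set0 cards0 mul0r; lra.
Qed.

Lemma top_weight_ge_card w p : (forall i, 1 <= w i) -> K%:R <= top_weight w p.
Proof.
move=> w1; rewrite /top_weight -[in leLHS](card_topK p Kn) -sumr_const.
by apply: ler_sum.
Qed.

Let K1 : 1 <= K%:R :> R. Proof. by rewrite ler1n. Qed.

Lemma top_weight_ge1 w p : (forall i, 1 <= w i) -> 1 <= top_weight w p.
Proof. by move=> w1; rewrite (le_trans K1)// top_weight_ge_card. Qed.

(** A player's utility from one user, divided by [beta], as a function of the weights alone; the
    average is over the ways of breaking ties. *)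
Definition share w i : R := (#|sorted_orders w|%:R)^-1 * \sum_(p in sorted_orders w)
  (if i \in topK K p then w i / top_weight w p * ln (top_weight w p) else 0).

Let share_cst w (c : R) :
  c = (#|sorted_orders w|%:R)^-1 * \sum_(p in sorted_orders w) c.
Proof.
rewrite sumr_const -[c *+ _]mulr_natl mulKf//.
by rewrite pnatr_eq0 -lt0n sorted_orders_neq0.
Qed.

Lemma sum_share w p : (forall i, 1 <= w i) -> p \in sorted_orders w ->
  \sum_i share w i = ln (top_weight w p).
Proof.
move=> w1 ps; rewrite -mulr_sumr exchange_big/= [RHS](share_cst w); congr (_ * _).
apply: eq_bigr => q qs; rewrite -big_mkcond/= (top_weight_eq ps qs).
have W0 : 0 < top_weight w q by rewrite (lt_le_trans ltr01)// top_weight_ge1.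
by rewrite -mulr_suml -mulr_suml divff ?gt_eqF// mul1r.
Qed.

Let term_ge0 w i p : (forall i, 1 <= w i) ->
  0 <= (if i \in topK K p then w i / top_weight w p * ln (top_weight w p) else 0).
Proof.
move=> w1; case: ifP => // _; have W1 := top_weight_ge1 p w1.
by rewrite mulr_ge0 ?ln_ge0// divr_ge0// (le_trans ler01).
Qed.

Lemma share_ge w i (c : R) :
  (forall p, p \in sorted_orders w -> i \in topK K p /\
     c <= w i / top_weight w p * ln (top_weight w p)) -> c <= share w i.
Proof.
move=> h; rewrite [leLHS](share_cst w) ler_wpM2l ?invr_ge0 ?ler0n//.
by apply: ler_sum => p /h[-> ].
Qed.

Lemma share_ge0 w i : (forall i, 1 <= w i) -> 0 <= share w i.
Proof.
by move=> w1; rewrite mulr_ge0 ?invr_ge0 ?ler0n//; apply: sumr_ge0 => p _; exact: term_ge0.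
Qed.

Lemma share_gt0 w i p : (forall i, 1 <= w i) -> p \in sorted_orders w -> i \in topK K p ->
  1 < top_weight w p -> 0 < share w i.
Proof.
move=> w1 ps iT W1; rewrite mulr_gt0 ?invr_gt0 ?ltr0n ?sorted_orders_neq0//.
rewrite (bigD1 p)//= iT ltr_pwDl//; last by apply: sumr_ge0 => q _; exact: term_ge0.
have w0 : 0 < w i by rewrite (lt_le_trans ltr01).
by rewrite mulr_gt0 ?ln_gt0// divr_gt0// (lt_trans ltr01).
Qed.

Section deviation.
Variables (w : 'I_n -> R) (i : 'I_n) (b : R) (p : {perm 'I_n}).
Hypothesis ps : p \in sorted_orders w.
Let w' l := if l == i then b else w l.

(** If [i] were left out, all [K] listed players would weigh at least [b], although one of them
    weighs at most the threshold. *)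
Lemma deviation_top q : threshold w p < b -> q \in sorted_orders w' -> i \in topK K q.
Proof.
move=> ab qs; apply: contraT => iT.
have [l lT lw] := exists_le_threshold ps (card_topK q Kn).
have h1 := threshold_le qs lT; have h2 := le_threshold_top qs iT.
move: h1 h2; rewrite /w' eqxx; case: eqP => [li|_]; last by lra.
by rewrite -li lT in iT.
Qed.

(** When [b] equals the threshold a sorted order may leave [i] out, but then some listed player has
    the same weight, and exchanging the two keeps the order sorted. *)
Lemma deviation_exists_top : threshold w p <= b ->
  exists2 q, q \in sorted_orders w' & i \in topK K q.
Proof.
move=> ab; have /card_gt0P[q qs] := sorted_orders_neq0 w'.
have [iT|iT] := boolP (i \in topK K q); first by exists q.
have [l lT lw] := exists_le_threshold ps (card_topK q Kn).
have li : l != i by apply: contraNneq iT => <-.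
have wli : w' l = w' i.
  have h1 := threshold_le qs lT; have h2 := le_threshold_top qs iT.
  by move: h1 h2; rewrite /w' eqxx (negbTE li) => h1 h2; apply/eqP; rewrite eq_le; apply/andP; split; lra.
have wt m : w' (tperm i l m) = w' m by case: tpermP => [->|->|].
exists (q * tperm i l)%g.
  by apply/sorted_ordersP => k k' kk'; rewrite !permM !wt; move/sorted_ordersP : qs; exact.
rewrite mem_topK in lT; apply/imsetP; exists (q^-1 l)%g; first by rewrite inE.
by rewrite permM permKV tpermR.
Qed.

End deviation.

End top_sets.

(** * Smoothness for a single user *)

Section sum_prod.
Context {R : realType} {I : finType}.
Implicit Types (P : pred I) (x : I -> R).

Lemma sum_le_prod1D P x : (forall i, 0 <= x i) ->
  1 + \sum_(i | P i) x i <= \prod_(i | P i) (1 + x i).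
Proof.
move=> x0; suff [] : 0 <= \sum_(i | P i) x i /\ 1 + \sum_(i | P i) x i <= \prod_(i | P i) (1 + x i) by [].
elim/big_rec2: _ => [|i y1 y2 _ [h0 h]]; first by rewrite addr0.
by have := x0 i; split; [lra|nra].
Qed.

(** The gain is the cross term [x i * x l] of the expanded product. *)
Lemma sum_lt_prod1D P x i l : (forall i, 0 <= x i) -> P i -> P l -> i != l ->
  0 < x i -> 0 < x l -> 1 + \sum_(i | P i) x i < \prod_(i | P i) (1 + x i).
Proof.
move=> x0 Pi Pl il xi xl.
pose Q j := (P j && (j != i)) && (j != l).
have Pli : P l && (l != i) by rewrite Pl eq_sym.
have -> : \sum_(j | P j) x j = x i + (x l + \sum_(j | Q j) x j) by rewrite (bigD1 i)//= (bigD1 l).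
have -> : \prod_(j | P j) (1 + x j) = (1 + x i) * ((1 + x l) * \prod_(j | Q j) (1 + x j)).
  by rewrite (bigD1 i)//= (bigD1 l).
have := @sum_le_prod1D Q _ x0; have : 0 <= \sum_(j | Q j) x j by apply: sumr_ge0.
set S := \sum_(_ | _) _; set M := \prod_(_ | _) _ => S0 SM.
apply: (@lt_le_trans _ _ ((1 + x i) * ((1 + x l) * (1 + S)))).
  have : 0 < x i * x l by rewrite mulr_gt0.
  have : 0 <= x i * S by rewrite mulr_ge0// ltW.
  have : 0 <= x l * S by rewrite mulr_ge0// ltW.
  have : 0 <= x i * x l * S by rewrite !mulr_ge0// ltW.
  by lra.
by rewrite !ler_wpM2l//; lra.
Qed.

Lemma sum_ln_prod P (f : I -> R) : (forall i, 0 < f i) ->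
  \sum_(i | P i) ln (f i) = ln (\prod_(i | P i) f i).
Proof.
move=> f0; rewrite -[LHS]expRK expR_sum; congr ln; apply: eq_bigr => i _.
by rewrite lnK ?posrE.
Qed.

End sum_prod.

Section smoothness.
Context {R : realType} {n : nat}.
Variables (beta : R) (K : nat).
Hypotheses (beta0 : 0 < beta) (K0 : (0 < K)%N) (Kn : (K <= n)%N).
Variables (w ws : 'I_n -> R) (p q : {perm 'I_n}).
Let B := expR beta^-1.
Hypotheses (w1 : forall i, 1 <= w i) (ws1 : forall i, 1 <= ws i <= B).
Hypothesis ps : p \in sorted_orders w.

Let dev i l := if l == i then ws i else w l.
Let a := threshold K0 Kn w p.
Let Z := top_weight K w p.
Let Zs := top_weight K ws q.
Let c := cbK beta K.
Let t i := share K (dev i) i.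
Let x i := Num.max (ws i - a) 0 / Z.

Let c0 : 0 < c. Proof. exact: cbK_gt0. Qed.
Let Z1 : 1 <= Z. Proof. exact: top_weight_ge1. Qed.
Let Z0 : 0 < Z. Proof. exact: lt_le_trans ltr01 Z1. Qed.
Let a1 : 1 <= a. Proof. exact: w1. Qed.
Let dev1 i l : 1 <= dev i l.
Proof. by rewrite /dev; case: ifP => // _; have /andP[] := ws1 i. Qed.
Let x0 i : 0 <= x i. Proof. by rewrite divr_ge0 ?le_max ?lexx ?orbT// ltW. Qed.
Let x10 i : 0 < 1 + x i. Proof. by rewrite (lt_le_trans ltr01)// lerDl. Qed.
Let KaZ : K%:R * a <= Z. Proof. exact: top_weight_ge. Qed.
Let K1 : 1 <= K%:R :> R. Proof. by rewrite ler1n. Qed.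

(** The numerator is [ws i - 1] rather than [ws i - a]. The surplus [a - 1] is kept because
    strictness for [K = 1] may have no other source. *)
Let share_dev_above i : a < ws i -> c * ln (1 + (ws i - 1) / Z) <= t i.
Proof.
move=> awi; apply: share_ge => // p' p's.
have iT : i \in topK K p' by exact: (deviation_top ps awi p's).
split => //; pose r := \sum_(l in topK K p' :\ i) w l.
have cU : #|topK K p' :\ i|%:R = K%:R - 1 :> R.
  have : #|topK K p'|%:R = #|topK K p' :\ i|%:R + 1 :> R by rewrite (cardsD1 i) iT add1n natr1.
  by rewrite card_topK//; lra.
have WE : top_weight K (dev i) p' = ws i + r.
  rewrite /top_weight (bigD1 i)//= {1}/dev eqxx; congr (_ + _).
  apply: eq_big => l; first by rewrite !inE andbC.
  by move=> /andP[_ li]; rewrite /dev (negbTE li).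
have Kr : K%:R <= r + 1.
  rewrite -lerBlDr -cU -sumr_const; exact: ler_sum.
(* The [K - 1] other listed players and the threshold together weigh at most [Z], and [a >= 1]. *)
have rZ : r + 1 <= Z.
  by have := top_weight_max K0 Kn (topK K p' :\ i) ps; rewrite cU -/a -/r -/Z; have := a1; lra.
have wi1 : 1 < ws i by have := a1; lra.
rewrite WE {1}/dev eqxx.
have r0 : 0 < r + 1 by have := K1; lra.
apply: le_trans (share_lower_bound beta0 K0 _ Kr); last first.
  by rewrite wi1; have /andP[] := ws1 i.
rewrite ler_pM2l// ler_ln ?posrE; last 2 first.
- by rewrite ltr_wpDr// divr_ge0 ?(ltW Z0)//; lra.
- by rewrite divr_gt0//; lra.
have -> : (ws i + r) / (r + 1) = 1 + (ws i - 1) / (r + 1) by field; rewrite gt_eqF.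
rewrite lerD2l ler_wpM2l ?lef_pV2 ?posrE//; lra.
Qed.

Let xE_le i : ws i <= a -> x i = 0.
Proof. by move=> h; rewrite /x max_r ?mul0r// subr_le0. Qed.

Let xE_gt i : a < ws i -> x i = (ws i - a) / Z.
Proof. by move=> h; rewrite /x max_l// subr_ge0 ltW. Qed.

Let x_gt0 i : a < ws i -> 0 < x i.
Proof. by move=> h; rewrite xE_gt// divr_gt0// subr_gt0. Qed.

Let x_ge i : (ws i - a) / Z <= x i.
Proof. by rewrite /x ler_pM2r ?invr_gt0// le_max lexx. Qed.

Let t_ge i : c * ln (1 + x i) <= t i.
Proof.
case: (leP (ws i) a) => h; first by rewrite xE_le// addr0 ln1 mulr0 share_ge0.
apply: le_trans (share_dev_above h); rewrite ler_pM2l// ler_ln ?posrE//.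
  rewrite lerD2l xE_gt// ler_pM2r ?invr_gt0//; have := a1; lra.
by rewrite ltr_wpDr// divr_ge0 ?(ltW Z0)//; have := a1; lra.
Qed.

Let t_gt i : 1 < a -> a < ws i -> c * ln (1 + x i) < t i.
Proof.
move=> a1' h; apply: lt_le_trans (share_dev_above h); rewrite ltr_pM2l// ltr_ln ?posrE//.
  rewrite ltrD2l xE_gt// ltr_pM2r ?invr_gt0//; lra.
by rewrite ltr_wpDr// divr_ge0 ?(ltW Z0)//; lra.
Qed.

Let t_ge0 i : 0 <= t i. Proof. exact: share_ge0. Qed.

Let sum_x : \sum_(i in topK K q) (ws i - a) / Z = (Zs - K%:R * a) / Z.
Proof. by rewrite -mulr_suml sumrB sumr_const card_topK// mulr_natl. Qed.

Let ratio_le : Zs / Z <= 1 + (Zs - K%:R * a) / Z.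
Proof.
have -> : 1 + (Zs - K%:R * a) / Z = (Z + Zs - K%:R * a) / Z by field; rewrite gt_eqF.
by rewrite ler_pM2r ?invr_gt0//; have := KaZ; lra.
Qed.

Let sum_x_le : 1 + (Zs - K%:R * a) / Z <= 1 + \sum_(i in topK K q) x i.
Proof. by rewrite lerD2l -sum_x ler_sum. Qed.

Let prod_le : 1 + \sum_(i in topK K q) x i <= \prod_(i in topK K q) (1 + x i).
Proof. exact: sum_le_prod1D. Qed.

Let sum_t_le : c * ln (\prod_(i in topK K q) (1 + x i)) <= \sum_i t i.
Proof.
rewrite -sum_ln_prod// mulr_sumr (le_trans (_ : _ <= \sum_(i in topK K q) t i))//.
  exact: ler_sum.
by rewrite [leLHS]big_mkcond; apply: ler_sum => i _; case: ifP.
Qed.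

Let Zs0 : 0 < Zs.
Proof.
apply: (lt_le_trans ltr01); apply: top_weight_ge1 => // i; by have /andP[] := ws1 i.
Qed.

Let lnE : ln Zs - ln Z = ln (Zs / Z). Proof. by rewrite ln_div ?posrE. Qed.

Let prod_gt0 : 0 < \prod_(i in topK K q) (1 + x i).
Proof. by apply: prodr_gt0. Qed.

Lemma smoothness : c * (ln Zs - ln Z) <= \sum_i share K (dev i) i.
Proof.
rewrite lnE (le_trans _ sum_t_le)// ler_pM2l// ler_ln ?posrE// ?divr_gt0//.
by rewrite (le_trans ratio_le)// (le_trans sum_x_le).
Qed.

Let strict_ratio : Zs / Z < \prod_(i in topK K q) (1 + x i) ->
  c * (ln Zs - ln Z) < \sum_i share K (dev i) i.
Proof.
by move=> h; rewrite lnE (lt_le_trans _ sum_t_le)// ltr_pM2l// ltr_ln ?posrE// ?divr_gt0.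
Qed.

Let strict_t l : l \in topK K q -> c * ln (1 + x l) < t l ->
  c * (ln Zs - ln Z) < \sum_i share K (dev i) i.
Proof.
move=> lT h; rewrite lnE (@le_lt_trans _ _ (c * ln (\prod_(i in topK K q) (1 + x i))))//.
  rewrite ler_pM2l// ler_ln ?posrE// ?divr_gt0//.
  by rewrite (le_trans ratio_le)// (le_trans sum_x_le).
rewrite -sum_ln_prod// mulr_sumr (bigD1 l)//= [ltRHS](bigD1 l)//= ltr_leD//.
rewrite big_mkcond [leRHS]big_mkcond; apply: ler_sum => i _.
by case: (i != l); rewrite ?andbT ?andbF//; case: ifP => _; [exact: t_ge|exact: t_ge0].
Qed.

(** The weights on the optimal list decide where slack is found. A weight below [a] gives a negative
    term [(ws l - a) / Z], whereas [x l = 0]. A weight equal to [a] also has [x l = 0], yet some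
    tie-breaking lists the deviator, whose share is then positive. If all weights exceed [a], the
    product has a cross term when [K >= 2]; when [K = 1] the threshold is [Z] itself, so [a > 1] and
    [share_dev_above] is strictly better than needed. *)
Lemma smoothness_strict : 1 < Z -> c * (ln Zs - ln Z) < \sum_i share K (dev i) i.
Proof.
move=> Z1'.
have [/exists_inP[l lT la]|/exists_inPn h1] := boolP [exists l in topK K q, ws l < a].
  apply: strict_ratio; apply: (le_lt_trans ratio_le); apply: lt_le_trans prod_le.
  rewrite ltrD2l -sum_x (bigD1 l)//= [ltRHS](bigD1 l)//= ltr_leD//.
    by rewrite xE_le ?ltW// pmulr_llt0 ?invr_gt0// subr_lt0.
  exact: ler_sum.
have a_le l : l \in topK K q -> a <= ws l by move=> /h1; rewrite -leNgt.
have Ka : (2 <= K)%N \/ 1 < a.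
  have [|K2] := leqP 2 K; [by left|right; apply: (lt_le_trans Z1')].
  have KE : K = 1%N by apply/eqP; rewrite eqn_leq K0 -ltnS K2.
  rewrite (le_trans (_ : _ <= \sum_(i in topK K p) a))//.
    by apply: ler_sum => i _; apply: (@le_threshold _ _ _ K0 Kn _ _ _ ps); rewrite mem_topK -leqNgt KE.
  by rewrite sumr_const card_topK// KE.
have [/exists_inP[l lT /eqP la]|/exists_inPn h2] := boolP [exists l in topK K q, ws l == a].
  have al : threshold K0 Kn w p <= ws l by rewrite la.
  have [p' p's lT'] := deviation_exists_top l ps al.
  apply: (strict_t lT); rewrite xE_le ?la// addr0 ln1 mulr0.
  apply: (share_gt0 K0 Kn (dev1 l) p's lT'); case: Ka => [K2|a1'].
    by apply: lt_le_trans (top_weight_ge_card Kn p' (dev1 l)); rewrite ltr1n.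
  rewrite /top_weight (bigD1 l)//= [dev l l]/dev eqxx la (lt_le_trans a1')// lerDl sumr_ge0// => i _.
  exact: le_trans ler01 (dev1 l i).
have a_lt l : l \in topK K q -> a < ws l.
  by move=> lT; rewrite lt_neqAle a_le// andbT eq_sym h2.
case: Ka => [K2|a1'].
  have /card_gt1P[i [l [iT lT il]]] : (1 < #|topK K q|)%N by rewrite card_topK.
  apply: strict_ratio; apply: (le_lt_trans ratio_le); apply: (le_lt_trans sum_x_le).
  by apply: (@sum_lt_prod1D _ _ _ _ i l) => //; apply: x_gt0; exact: a_lt.
have /card_gt0P[l lT] : (0 < #|topK K q|)%N by rewrite card_topK.
by apply: (strict_t lT); exact: t_gt (a_lt _ lT).
Qed.

End smoothness.

Local Open Scope classical_set_scope.

(** * Averaging over an equilibrium *)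

Section smooth_average.
Context {R : realType} {d : measure_display} {Omega : measurableType d}.
Variables (P : probability Omega R) (I : finType) (U D : I -> Omega -> R) (W : Omega -> R).
Variables (c Ws M : R).
Hypotheses (c0 : 0 < c) (Ws0 : 0 <= Ws).
Hypotheses (mU : forall i, measurable_fun setT (U i)) (mD : forall i, measurable_fun setT (D i)).
Hypothesis mW : measurable_fun setT W.
Hypotheses (UM : forall i w, 0 <= U i w <= M) (DM : forall i w, 0 <= D i w <= M).
Hypothesis WM : forall w, 0 <= W w <= M.
Hypothesis WU : forall w, W w = \sum_i U i w.
Hypothesis DU : forall i, (\int[P]_w (D i w)%:E <= \int[P]_w (U i w)%:E)%E.
Hypothesis smooth : forall w, c * (Ws - W w) <= \sum_i D i w.
Hypothesis smooth_strict : forall w, 0 < W w -> c * (Ws - W w) < \sum_i D i w.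

Let integrable_bounded (f : Omega -> R) : measurable_fun setT f ->
  (forall w, 0 <= f w <= M) -> P.-integrable setT (EFin \o f).
Proof.
move=> mf fM; apply: (le_integrable _ _ _ (finite_measure_integrable_cst P M measurableT)) => //.
  exact/measurable_EFinP.
move=> w _ /=; rewrite lee_fin; have /andP[f0 f1] := fM w.
by rewrite !ger0_norm// (le_trans f0).
Qed.

Let Dt w := \sum_i D i w.
Let iW : P.-integrable setT (EFin \o W). Proof. exact: integrable_bounded. Qed.
Let iU i : P.-integrable setT (EFin \o U i). Proof. exact: integrable_bounded. Qed.
Let iD i : P.-integrable setT (EFin \o D i). Proof. exact: integrable_bounded. Qed.
Let iDt : P.-integrable setT (EFin \o Dt).
Proof.
have := @integrable_sum _ _ _ P setT measurableT I (index_enum I) xpredT (fun i => EFin \o D i) (fun i _ => iD i).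
by apply: eq_integrable => // w _ /=; rewrite /Dt sumEFin.
Qed.

Let intDt : (\int[P]_w (Dt w)%:E <= \int[P]_w (W w)%:E)%E.
Proof.
have -> : (\int[P]_w (Dt w)%:E = \sum_i \int[P]_w (D i w)%:E)%E.
  rewrite -(integral_sum measurableT iD); apply: eq_integral => w _.
  by rewrite /= sumEFin.
have -> : (\int[P]_w (W w)%:E = \sum_i \int[P]_w (U i w)%:E)%E.
  rewrite -(integral_sum measurableT iU); apply: eq_integral => w _.
  by rewrite /= sumEFin WU.
exact: lee_sum.
Qed.

Let ew := Rintegral P setT W.
Let ewE : (\int[P]_w (W w)%:E = ew%:E)%E.
Proof. by rewrite /ew /Rintegral fineK//; exact: integrable_fin_num iW. Qed.

Let Dle : Rintegral P setT Dt <= ew.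
Proof.
move: intDt; rewrite ewE /Rintegral => h; rewrite -lee_fin fineK//.
exact: integrable_fin_num iDt.
Qed.

Let G w := Dt w - (c * Ws - c * W w).

Let iC : P.-integrable setT (EFin \o (fun w => c * Ws - c * W w)).
Proof.
have iW' := integrableZl measurableT c iW.
have := integrableB measurableT (finite_measure_integrable_cst P (c * Ws) measurableT) iW'.
exact: eq_integrable.
Qed.

Let iG : P.-integrable setT (EFin \o G).
Proof. by have := integrableB measurableT iDt iC; exact: eq_integrable. Qed.

Let intG : Rintegral P setT G = Rintegral P setT Dt - (c * Ws - c * ew).
Proof.
have iW' : P.-integrable setT (EFin \o (fun w => c * W w)).
  by have := integrableZl measurableT c iW; exact: eq_integrable.
rewrite /G RintegralB//; congr (_ - _).
rewrite RintegralB//; last exact: finite_measure_integrable_cst.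
rewrite Rintegral_cst// RintegralZl//; congr (_ - _); rewrite -[RHS]mulr1; congr (_ * _).
exact: (congr1 fine (probability_setT P)).
Qed.

Let G0 w : 0 <= G w. Proof. by have := smooth w; rewrite /G /Dt; lra. Qed.

(** [G] is the pointwise slack in the smoothness inequality. If the strict bound fails, the
    equilibrium condition forces the integral of [G >= 0] to vanish, so [G = 0] almost everywhere.
    Slack is positive wherever [W > 0], hence [W = 0] almost everywhere, and the integrated
    inequality then leaves [Ws = 0]. *)
Lemma smooth_average :
  (Ws%:E < (1 + c^-1)%:E * \int[P]_w (W w)%:E)%E \/ Ws = 0 /\ (\int[P]_w (W w)%:E = 0)%E.
Proof.
rewrite ewE -EFinM lte_fin.
have [|h] := ltP Ws ((1 + c^-1) * ew); [by left|right].
have h' : (1 + c) * ew <= c * Ws.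
  have := ler_wpM2l (ltW c0) h; rewrite mulrA mulrDr mulr1 mulfV ?gt_eqF//.
  by rewrite [c + 1]addrC.
have Gint0 : Rintegral P setT G = 0.
  have Gi0 : 0 <= Rintegral P setT G by apply: Rintegral_ge0 => w _; exact: G0.
  apply/eqP; rewrite eq_le Gi0 andbT intG.
  by have := Dle; lra.
have Gae : ae_eq P setT (EFin \o G) (cst 0%E).
  apply/(ae_eq_integral_abs P measurableT); first exact: measurable_int iG.
  rewrite (eq_integral (EFin \o G)); last by move=> w _ /=; rewrite ger0_norm.
  have /fineK <- := integrable_fin_num measurableT iG.
  by rewrite -[fine _]/(Rintegral P setT G) Gint0.
have ew0 : ew = 0.
  apply: EFin_inj; rewrite -ewE (@ae_eq_integral _ _ _ _ _ (cst 0%E))//.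
  - by rewrite integral0.
  - exact/measurable_EFinP.
  apply: filterS Gae => w /= Gw _; have := Gw Logic.I => -[] {}Gw.
  congr EFin; apply/eqP; rewrite eq_le; have /andP[-> _] := WM w; rewrite andbT leNgt.
  apply/negP => /smooth_strict; move: Gw; rewrite /G /Dt; lra.
split; last by rewrite ew0.
apply/eqP; rewrite eq_le Ws0 andbT -(pmulr_rle0 _ c0).
have : 0 <= Rintegral P setT G by rewrite Gint0.
by rewrite intG; have := Dle; rewrite ew0; lra.
Qed.

End smooth_average.

Local Close Scope classical_set_scope.

(** * From one user to the whole game *)

Section utilities.
Context {R : realType} {dd n m : nat}.
Variables (beta : R) (K : nat) (sigma : 'rV[R]_dd -> 'rV[R]_dd -> R) (X : 'I_m -> 'rV[R]_dd).
Hypotheses (beta0 : 0 < beta) (K0 : (0 < K)%N) (Kn : (K <= n)%N).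
Hypothesis sigma01 : forall a b, 0 <= sigma a b <= 1.
Implicit Types (s : 'I_n -> 'rV[R]_dd) (x : 'rV[R]_dd) (i : 'I_n) (p : {perm 'I_n}).

Definition weight s x i : R := expR (sigma (s i) x / beta).

Lemma weight_bounds s x i : 1 <= weight s x i <= expR beta^-1.
Proof.
have /andP[s0 s1] := sigma01 (s i) x.
rewrite /weight -[X in X <= _ <= _]expR0 !ler_expR; apply/andP; split.
  by rewrite divr_ge0// ltW.
by rewrite ler_pdivrMr// mulVf ?gt_eqF.
Qed.

Let weight1 s x i : 1 <= weight s x i.
Proof. by have /andP[] := weight_bounds s x i. Qed.

Lemma valid_ordersE s x : valid_orders sigma s x = sorted_orders (weight s x).
Proof.
apply/setP => p; rewrite !inE; apply: eq_forallb => k; apply: eq_forallb => k'.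
by rewrite /weight ler_expR ler_pM2r ?invr_gt0.
Qed.

Lemma user_utilityE s x p : p \in sorted_orders (weight s x) ->
  user_utility beta K sigma s x = beta * ln (top_weight K (weight s x) p).
Proof.
move=> ps; rewrite /user_utility valid_ordersE.
rewrite (eq_bigr (fun=> beta * ln (top_weight K (weight s x) p))); last first.
  move=> q qs; rewrite gexp_noisy_max// ?card_topK//.
  by rewrite (top_weight_eq K0 Kn ps qs).
rewrite sumr_const -[(_ * _) *+ _]mulr_natl mulKf//.
by rewrite pnatr_eq0 -lt0n sorted_orders_neq0.
Qed.

Lemma player_utilityE s i :
  player_utility beta K sigma X s i = \sum_(j < m) beta * share K (weight s (X j)) i.
Proof.
apply: eq_bigr => j _; rewrite valid_ordersE /share [RHS]mulrCA; congr (_ * _); rewrite mulr_sumr.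
apply: eq_bigr => p ps; case: ifPn => iT; last by rewrite gexp_notin// mulr0.
rewrite gexp_chosen//=; first by rewrite mulrCA.
by have /andP[] := sigma01 (s i) (X j).
Qed.

Let user_utility_sum s x : user_utility beta K sigma s x = beta * \sum_i share K (weight s x) i.
Proof.
have /card_gt0P[p ps] := sorted_orders_neq0 (weight s x).
by rewrite (user_utilityE ps) (sum_share K0 Kn (weight1 s x) ps).
Qed.

Lemma welfareE s : welfare beta K sigma X s = \sum_i player_utility beta K sigma X s i.
Proof.
under eq_bigr => i _ do rewrite player_utilityE.
by rewrite exchange_big; apply: eq_bigr => j _; rewrite user_utility_sum mulr_sumr.
Qed.

Lemma player_utility_ge0 s i : 0 <= player_utility beta K sigma X s i.
Proof.
rewrite player_utilityE; apply: sumr_ge0 => j _; apply: mulr_ge0; first exact: ltW.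
by apply: share_ge0.
Qed.

Let bound : R := m%:R * (beta * (n%:R * expR beta^-1)).

(** Crude, from [ln Z <= Z <= n * exp (1 / beta)]: a bound uniform in [s] suffices, as it serves
    only integrability. *)
Lemma welfare_bounds s : 0 <= welfare beta K sigma X s <= bound.
Proof.
apply/andP; split; first by rewrite welfareE; apply: sumr_ge0 => i _; exact: player_utility_ge0.
rewrite /bound mulr_natl -[m in _ *+ m]card_ord -sumr_const; apply: ler_sum => j _.
have /card_gt0P[p ps] := sorted_orders_neq0 (weight s (X j)).
rewrite (user_utilityE ps) ler_pM2l//.
have Z1 := top_weight_ge1 K0 Kn p (weight1 s (X j)).
rewrite (le_trans (ltW (ln_sublinear (lt_le_trans ltr01 Z1))))//.
rewrite /top_weight mulr_natl -[n in _ *+ n]card_ord -sumr_const.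
rewrite big_mkcond; apply: ler_sum => i _; case: ifP => _; last exact: expR_ge0.
by have /andP[] := weight_bounds s (X j) i.
Qed.

Lemma player_utility_bounds s i : 0 <= player_utility beta K sigma X s i <= bound.
Proof.
rewrite player_utility_ge0/=; have /andP[_] := welfare_bounds s; apply: le_trans.
by rewrite welfareE (bigD1 i)//= lerDl sumr_ge0// => l _; exact: player_utility_ge0.
Qed.

Section deviations.
Variables s s' : 'I_n -> 'rV[R]_dd.

Let weight_deviate x i : weight (deviate s i (s' i)) x =
  fun l => if l == i then weight s' x i else weight s x l.
Proof. by apply/funext => l; rewrite /weight /deviate; case: ifP. Qed.

Let sum_deviations : \sum_i player_utility beta K sigma X (deviate s i (s' i)) i =
  \sum_(j < m) beta * \sum_i share K (fun l => if l == i then weight s' (X j) i else weight s (X j) l) i.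
Proof.
under eq_bigr => i _ do rewrite player_utilityE.
rewrite exchange_big; apply: eq_bigr => j _; rewrite mulr_sumr; apply: eq_bigr => i _.
by rewrite weight_deviate.
Qed.

Let dev_share x :=
  beta * \sum_i share K (fun l => if l == i then weight s' x i else weight s x l) i.

Let user_smooth x :
  cbK beta K * (user_utility beta K sigma s' x - user_utility beta K sigma s x) <= dev_share x.
Proof.
have /card_gt0P[p ps] := sorted_orders_neq0 (weight s x).
have /card_gt0P[q qs] := sorted_orders_neq0 (weight s' x).
rewrite (user_utilityE ps) (user_utilityE qs) -mulrBr mulrCA ler_pM2l//.
by apply: smoothness => // i; exact: weight_bounds.
Qed.

Let user_smooth_strict x : 0 < user_utility beta K sigma s x ->
  cbK beta K * (user_utility beta K sigma s' x - user_utility beta K sigma s x) < dev_share x.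
Proof.
have /card_gt0P[p ps] := sorted_orders_neq0 (weight s x).
have /card_gt0P[q qs] := sorted_orders_neq0 (weight s' x).
rewrite (user_utilityE ps) (user_utilityE qs) pmulr_rgt0// -mulrBr mulrCA ltr_pM2l// => lnZ.
apply: smoothness_strict => //; first by move=> i; exact: weight_bounds.
by rewrite ltNge; apply/negP => /ln_le0; rewrite leNgt lnZ.
Qed.

Let welfare_diff : cbK beta K * (welfare beta K sigma X s' - welfare beta K sigma X s) =
  \sum_(j < m) cbK beta K * (user_utility beta K sigma s' (X j) - user_utility beta K sigma s (X j)).
Proof. by rewrite /welfare -sumrB mulr_sumr. Qed.

Lemma welfare_smooth : cbK beta K * (welfare beta K sigma X s' - welfare beta K sigma X s) <=
  \sum_i player_utility beta K sigma X (deviate s i (s' i)) i.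
Proof. by rewrite welfare_diff sum_deviations; apply: ler_sum => j _; exact: user_smooth. Qed.

Lemma welfare_smooth_strict : 0 < welfare beta K sigma X s ->
  cbK beta K * (welfare beta K sigma X s' - welfare beta K sigma X s) <
  \sum_i player_utility beta K sigma X (deviate s i (s' i)) i.
Proof.
move=> W0; rewrite welfare_diff sum_deviations.
(* A single user with positive utility gives the strict inequality; the other users need only the
   weak one. *)
have [j Wj] : exists j, 0 < user_utility beta K sigma s (X j).
  apply/existsP; apply: contraTT W0; rewrite negb_exists => /forallP h.
  by rewrite -leNgt; apply: sumr_le0 => j _; rewrite leNgt h.
rewrite (bigD1 j)//= [ltRHS](bigD1 j)//= ltr_leD ?user_smooth_strict//.
by apply: ler_sum => l _; exact: user_smooth.
Qed.

End deviations.
End utilities.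

(** The ratio is cleared of its denominator, and an arbitrary [s_opt] stands for the maximiser, so
    attainment of the maximum is not at issue. The second alternative is the ratio [0 / 0], which
    does occur: for [K = 1] and [sigma] identically 0 every user's utility is [beta * ln 1 = 0]. *)
Theorem theorem1 (R : realType) (dd n m : nat)
  (S : 'I_n -> set 'rV[R]_dd) (X : 'I_m -> 'rV[R]_dd)
  (sigma : 'rV[R]_dd -> 'rV[R]_dd -> R) (beta : R) (K : nat) :
  injective X ->
  (forall a b, 0 <= sigma a b <= 1) ->
  0 < beta ->
  (1 <= K <= n)%N ->
  forall s_opt : 'I_n -> 'rV[R]_dd, (forall i, S i (s_opt i)) ->
  forall (d : measure_display) (Omega : measurableType d)
         (P : probability Omega R) (s : Omega -> 'I_n -> 'rV[R]_dd),
  is_CCE beta K S sigma X P s ->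
  let EW := (\int[P]_w (welfare beta K sigma X (s w))%:E)%E in
  ((welfare beta K sigma X s_opt)%:E < (1 + (cbK beta K)^-1)%:E * EW)%E
  \/ (welfare beta K sigma X s_opt = 0 /\ EW = 0%E).
Proof.
move=> _ sigma01 beta0 /andP[K0 Kn] s_opt Ss_opt d Omega P s [[_ mU mD mW] cce] EW.
apply: (@smooth_average _ _ _ P _
  (fun i w => player_utility beta K sigma X (s w) i)
  (fun i w => player_utility beta K sigma X (deviate (s w) i (s_opt i)) i)
  _ _ _ (m%:R * (beta * (n%:R * expR beta^-1)))) => //.
- exact: cbK_gt0.
- by have /andP[] := welfare_bounds X beta0 K0 Kn sigma01 s_opt.
- by move=> i; exact: mD.
- by move=> i w; exact: player_utility_bounds.
- by move=> i w; exact: player_utility_bounds.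
- by move=> w; exact: welfare_bounds.
- by move=> w; exact: welfareE.
- by move=> i; exact: cce.
- by move=> w; exact: welfare_smooth.
- by move=> w; exact: welfare_smooth_strict.
Qed.
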